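(* Let $R$ be a ring, $G$ a finite group acting on $R$, $H$ a subgroup of $G$, $M$ an $RH$-module and $N$ an $RG$-module. Then: (1) $\mathrm{cid}_{RH}(N\downarrow_H^G)\le\mathrm{cid}_{RG}(N)$, and equality holds when $RG$ is a separable extension over $RH$. (2) $\mathrm{cid}_{RG}(M\uparrow_H^G)=\mathrm{cid}_{RH}(M)$. (3) $\mathrm{cfd}_{RG}(M\uparrow_H^G)=\mathrm{cfd}_{RH}(M)$. (4) $\mathrm{cfd}_{RH}(N\downarrow_H^G)\le\mathrm{cfd}_{RG}(N)$, and equality holds when $RG$ is a separable extension over $RH$.
   Context: Rings are associative with identity; modules are unitary and are left modules unless otherwise specified. $G$ acts on $R$ by ring automorphisms: $r\mapsto g(r)$ is a ring automorphism for each $g\in G$, $(g_1g_2)(r)=g_1(g_2(r))$ and $1(r)=r$. The skew group ring $RG$ is the free left $R$-module with basis $G$ and multiplication $(ag)(bh)=a\,g(b)\,gh$ for $a,b\in R$, $g,h\in G$. For a subgroup $H\le G$ (with the restricted action), $RH$ is a subring of $RG$. For an $RH$-module $M$, $M\uparrow_H^G=RG\otimes_{RH}M$ is the induced $RG$-module; for an $RG$-module $N$, $N\downarrow_H^G$ is $N$ viewed as an $RH$-module by restriction of scalars. A ring $A$ is a separable extension over a subring $S$ if the multiplication map $A\otimes_S A\to A$, $a\otimes b\mapsto ab$, splits as a map of $A$-$A$-bimodules; i.e. there is $\sum_i a_i\otimes b_i\in A\otimes_S A$ with $\sum_i a_i\otimes b_i a=\sum_i a a_i\otimes b_i$ for all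 $a\in A$ and $\sum_i a_ib_i=1$. For an $A$-module $M$: the copure flat dimension $\mathrm{cfd}_A(M)$ is the smallest integer $n\ge0$ such that $\operatorname{Tor}^A_{n+i}(E,M)=0$ for every injective right $A$-module $E$ and every integer $i\ge1$; the copure injective dimension $\mathrm{cid}_A(M)$ is the smallest integer $n\ge0$ such that $\operatorname{Ext}_A^{n+i}(E,M)=0$ for every injective $A$-module $E$ and every integer $i\ge1$. Each is $\infty$ if no such $n$ exists. *)

(* Defs.v *)
From HB Require Import structures.
From mathcomp Require Import all_boot all_order all_fingroup all_algebra.
From mathcomp Require Import boolp classical_sets functions cardinality fsbigop.
From mathcomp Require Import constructive_ereal finmap.

Set Implicit Arguments.
Unset Strict Implicit.
Unset Printing Implicit Defensive.

Import GRing.Theory.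
Local Open Scope ring_scope.
Local Open Scope quotient_scope.

(* Left A-modules are lmodType A; right A-modules are lmodType A^c, so that   *)
(* the right action e . a is written (a : A^c) *: e.                          *)

Section FreeModule.
Variables (A : pzRingType) (T : choiceType).

Definition fin_supp : {pred T -> A^o} :=
  fun f => `[< finite_set [set x | f x != 0]%classic >].

Lemma fin_supp_submod : submod_closed fin_supp.
Proof.
split=> [|a u v /asboolP fu /asboolP fv]; apply/asboolP.
  by apply: (sub_finite_set _ (finite_set0 T)) => x /=; rewrite eqxx.
apply: (@sub_finite_set _ _ ([set x | u x != 0] `|` [set x | v x != 0])%classic).
  move=> x /=; apply: contra_neqP => /not_orP[/negP + /negP].
  rewrite !negbK => /eqP ux /eqP vx.
  by rewrite -[LHS]/(a *: u x + v x) ux vx scaler0 addr0.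
by rewrite finite_setU.
Qed.

HB.instance Definition _ := GRing.isSubmodClosed.Build A (T -> A^o) fin_supp
  fin_supp_submod.

(* The free left A-module with basis T. *)
Record free_mod := FreeMod { free_val :> T -> A^o; _ : free_val \in fin_supp }.

HB.instance Definition _ := [isSub for free_val].
HB.instance Definition _ := [Choice of free_mod by <:].
HB.instance Definition _ := [SubChoice_isSubLmodule of free_mod by <:].

Lemma free_fin (f : free_mod) : finite_set [set x | f x != 0]%classic.
Proof. by case: f => f /= /asboolP. Qed.

Lemma basis_subproof (t : T) : (fun x => (x == t)%:R : A^o) \in fin_supp.
Proof.
apply/asboolP; apply: (sub_finite_set _ (finite_set1 t)) => x /=.
by case: (x =P t) => // _; rewrite eqxx.
Qed.

Definition free_basis (t : T) : free_mod := FreeMod (basis_subproof t).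

Lemma free_suppE (f : free_mod) : exists2 r : seq T, uniq r &
  (forall x, x \notin r -> f x = 0).
Proof.
exists (fset_set [set x | f x != 0]%classic); first exact: finmap.fset_uniq.
move=> x; rewrite in_fset_set; last exact: free_fin.
by rewrite notin_setE /= => /negP; rewrite negbK => /eqP.
Qed.

Lemma free_decomp (r : seq T) (f : free_mod) : uniq r ->
  (forall x, x \notin r -> f x = 0) ->
  f = \sum_(x <- r) (f x : A) *: free_basis x.
Proof.
move=> ur fr; apply: val_inj; apply/funext => y /=.
rewrite (@big_morph _ _ (fun g : free_mod => (g y : A)) 0 +%R) //=.
transitivity (\sum_(x <- r) (f x : A) * (y == x)%:R); last first.
  by apply: eq_bigr.
have [yr|yr] := boolP (y \in r).
  rewrite (big_rem y) //= eqxx mulr1 big_seq big1 ?addr0 // => z.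
  rewrite mem_rem_uniq // inE => /andP[/negbTE zy _].
  by rewrite eq_sym zy mulr0.
rewrite fr // big_seq big1 // => z zr.
by case: eqP yr => [->|_]; rewrite ?zr ?mulr0.
Qed.

Section Lift.
Variables (V : lmodType A) (b : T -> V).

Definition free_lift (f : free_mod) : V := \sum_(x \in setT) (f x : A) *: b x.

Lemma free_liftE (r : seq T) (f : free_mod) : uniq r ->
  (forall x, x \notin r -> f x = 0) ->
  free_lift f = \sum_(x <- r) (f x : A) *: b x.
Proof.
move=> ur fr; rewrite /free_lift (fsbigE r) //=.
  by apply: eq_bigl => x; rewrite in_setT.
by move=> x _ /fr ->; rewrite scale0r.
Qed.

Lemma free_lift_linear : linear free_lift.
Proof.
move=> a f g; have [r1 _ h1] := free_suppE f; have [r2 _ h2] := free_suppE g.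
have e x : (a *: f + g) x = a * f x + g x by [].
have ur := undup_uniq (r1 ++ r2).
have nr x : x \notin undup (r1 ++ r2) -> f x = 0 /\ g x = 0.
  by rewrite mem_undup mem_cat negb_or => /andP[/h1 ? /h2 ?].
rewrite !(free_liftE ur) ?scaler_sumr -?big_split.
- by apply: eq_bigr => x _; rewrite e scalerDl scalerA.
- by move=> x /nr[].
- by move=> x /nr[].
- by move=> x /nr[fx gx]; rewrite e fx gx mulr0 addr0.
Qed.

HB.instance Definition _ := GRing.isLinear.Build A free_mod V _ free_lift
  free_lift_linear.

Lemma free_lift_basis t : free_lift (free_basis t) = b t.
Proof.
rewrite (@free_liftE [:: t]) //= => [|x].
  by rewrite big_seq1 /= eqxx scale1r.
by rewrite inE /= => /negbTE ->.
Qed.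

Lemma free_lift_uniq (h : {linear free_mod -> V}) :
  (forall t, h (free_basis t) = b t) -> h =1 free_lift.
Proof.
move=> hb f; have [r ur fr] := free_suppE f.
rewrite {1}(free_decomp ur fr) linear_sum (free_liftE ur fr).
by apply: eq_bigr => x _; rewrite linearZ /= hb.
Qed.

End Lift.
End FreeModule.
Arguments free_basis {A T}.

Section Tensor.
Variables (A : pzRingType) (E : lmodType A^c) (M : lmodType A).

Local Notation gen e m := (free_basis (e, m) : free_mod int (E * M)%type).

Inductive tensor_rel : free_mod int (E * M)%type -> Prop :=
| TensorRel0 : tensor_rel 0
| TensorRelB x y : tensor_rel x -> tensor_rel y -> tensor_rel (x - y)
| TensorRelDl e1 e2 m : tensor_rel (gen (e1 + e2) m - gen e1 m - gen e2 m)
| TensorRelDr e m1 m2 : tensor_rel (gen e (m1 + m2) - gen e m1 - gen e m2)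
| TensorRelM e (a : A) m :
    tensor_rel (gen ((a : A^c) *: e) m - gen e (a *: m)).

(* E (x)_A M is the free abelian group on E x M modulo tensor_rel. *)
Definition tensor_rels : {pred free_mod int (E * M)%type} :=
  fun x => `[< tensor_rel x >].

Lemma tensor_rels_zmod : zmod_closed tensor_rels.
Proof.
split=> [|x y /asboolP hx /asboolP hy]; apply/asboolP.
  exact: TensorRel0.
exact: TensorRelB.
Qed.

HB.instance Definition _ := GRing.isZmodClosed.Build _ tensor_rels
  tensor_rels_zmod.

Definition tensor := Quotient.quot tensor_rels.

HB.instance Definition _ := GRing.Zmodule.on tensor.

Definition tensor_pi : free_mod int (E * M)%type -> tensor :=
  \pi_(Quotient.quot tensor_rels).

Lemma tensor_pi_zmod : zmod_morphism tensor_pi.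
Proof. by move=> x y; rewrite /tensor_pi !piE. Qed.

HB.instance Definition _ := GRing.isZmodMorphism.Build _ _ tensor_pi
  tensor_pi_zmod.

Lemma tensor_pi_eq0 x : tensor_pi x = 0 <-> tensor_rel x.
Proof.
rewrite -(raddf0 tensor_pi); split.
  by move=> /eqmodP; rewrite /= /Quotient.equiv subr0 => /asboolP.
by move=> h; apply/eqmodP; rewrite /= /Quotient.equiv subr0; apply/asboolP.
Qed.

Lemma tensor_pi_surj (t : tensor) : exists x, t = tensor_pi x.
Proof. by exists (generic_quotient.repr t); rewrite /tensor_pi reprK. Qed.

Definition tens (e : E) (m : M) : tensor := tensor_pi (gen e m).

Lemma tensDl e1 e2 m : tens (e1 + e2) m = tens e1 m + tens e2 m.
Proof.
apply/eqP; rewrite -subr_eq0 opprD addrA -!raddfB; apply/eqP/tensor_pi_eq0.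
exact: TensorRelDl.
Qed.

Lemma tensDr e m1 m2 : tens e (m1 + m2) = tens e m1 + tens e m2.
Proof.
apply/eqP; rewrite -subr_eq0 opprD addrA -!raddfB; apply/eqP/tensor_pi_eq0.
exact: TensorRelDr.
Qed.

Lemma tensNl e m : tens (- e) m = - tens e m.
Proof.
have t0 : tens 0 m = 0 by apply: (addrI (tens 0 m)); rewrite -tensDl !addr0.
by apply/eqP; rewrite -addr_eq0 -tensDl addNr t0.
Qed.

Lemma tensM e (a : A) m : tens ((a : A^c) *: e) m = tens e (a *: m).
Proof.
apply/eqP; rewrite -subr_eq0 -!raddfB; apply/eqP/tensor_pi_eq0.
exact: TensorRelM.
Qed.

(* The additive map out of the tensor product induced by b; it is meaningful  *)
(* when b is biadditive and A-balanced, see tensor_lift_tens.                 *)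
Definition tensor_lift (X : zmodType) (b : E -> M -> X) (t : tensor) : X :=
  free_lift (fun p : (E * M)%type => b p.1 p.2 : zmodule X) (generic_quotient.repr t).

Section TensorLift.
Variables (X : zmodType) (b : E -> M -> X).
Hypothesis bDl : forall e1 e2 m, b (e1 + e2) m = b e1 m + b e2 m.
Hypothesis bDr : forall e m1 m2, b e (m1 + m2) = b e m1 + b e m2.
Hypothesis bM : forall e (a : A) m, b ((a : A^c) *: e) m = b e (a *: m).

Lemma tensor_lift_pi x :
  tensor_lift b (tensor_pi x) = free_lift (fun p => b p.1 p.2 : zmodule X) x.
Proof.
have rel0 y : tensor_rel y -> free_lift (fun p => b p.1 p.2 : zmodule X) y = 0.
  elim=> [|y1 y2 _ h1 _ h2|e1 e2 m|e m1 m2|e a m].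
  - exact: raddf0.
  - by rewrite raddfB /= h1 h2 subr0.
  - by rewrite !raddfB /= !free_lift_basis /= bDl -addrA -opprD subrr.
  - by rewrite !raddfB /= !free_lift_basis /= bDr -addrA -opprD subrr.
  - by rewrite !raddfB /= !free_lift_basis /= bM subrr.
have := rel0 (generic_quotient.repr (tensor_pi x) - x).
rewrite raddfB /= => h; apply/eqP; rewrite -subr_eq0; apply/eqP/h.
by apply/tensor_pi_eq0; rewrite raddfB /= {1}/tensor_pi reprK subrr.
Qed.

Lemma tensor_lift_zmod : zmod_morphism (tensor_lift b).
Proof.
move=> s t; have [x ->] := tensor_pi_surj s; have [y ->] := tensor_pi_surj t.
by rewrite -raddfB !tensor_lift_pi raddfB.
Qed.

Lemma tensor_lift_tens e m : tensor_lift b (tens e m) = b e m.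
Proof. by rewrite tensor_lift_pi free_lift_basis. Qed.

End TensorLift.

Lemma tensor_ind (P : tensor -> Prop) : P 0 ->
  (forall e m, P (tens e m)) -> (forall s t, P s -> P t -> P (s + t)) ->
  forall t, P t.
Proof.
move=> P0 Pt PD t; have [x ->] := tensor_pi_surj t.
have [r ur xr] := free_suppE x; rewrite (free_decomp ur xr).
elim: r {ur xr} => [|p r IHr]; first by rewrite big_nil raddf0.
rewrite big_cons raddfD; apply: (PD) => //=.
case: p => e m; have Pn k e' : P (tens e' m *+ k).
  by elim: k => [//|k IHk]; rewrite mulrS; apply: (PD).
rewrite -[x _]intz scaler_int raddfMz -/(tens e m).
case: (free_val x _) => n; first exact: Pn.
by rewrite NegzE mulrNz -mulNrz -tensNl; exact: Pn.
Qed.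

Lemma tensor_ext (X : zmodType) (u v : {additive tensor -> X}) :
  (forall e m, u (tens e m) = v (tens e m)) -> u =1 v.
Proof.
move=> uv; apply: tensor_ind => [|//|s t]; first by rewrite !raddf0.
by rewrite !raddfD => -> ->.
Qed.

End Tensor.

Section TensorMap.
Variables (A : pzRingType) (E E' : lmodType A^c) (M M' : lmodType A).
Variables (u : {linear E -> E'}) (v : {linear M -> M'}).

Definition tensor_map : tensor E M -> tensor E' M' :=
  tensor_lift (fun e m => tens (u e) (v m)).

Lemma tensor_map_zmod : zmod_morphism tensor_map.
Proof.
apply: tensor_lift_zmod => [e1 e2 m|e m1 m2|e a m].
- by rewrite linearD tensDl.
- by rewrite linearD tensDr.
- by rewrite !linearZ tensM.
Qed.

HB.instance Definition _ := GRing.isZmodMorphism.Build _ _ tensor_map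
  tensor_map_zmod.

Lemma tensor_map_tens e m : tensor_map (tens e m) = tens (u e) (v m).
Proof.
apply: tensor_lift_tens => [e1 e2 m'|e' m1 m2|e' a m'].
- by rewrite linearD tensDl.
- by rewrite linearD tensDr.
- by rewrite !linearZ tensM.
Qed.

End TensorMap.

Section ChangeOfRings.
Variables (A B : pzRingType) (f : {rmorphism B -> A}).

(* A as a right B-module along f; f is a phantom parameter on which the       *)
(* module structure depends, as in res_scalars below.                            *)
Definition right_regular_along (_ : B -> A) : Type := A.
Local Notation right_regular := (right_regular_along f).

HB.instance Definition _ := GRing.Zmodule.on right_regular.

Definition rr_scale (b : B^c) (x : right_regular) : right_regular :=
  (x : A) * f b.

Lemma rr_scaleA b c x : rr_scale b (rr_scale c x) = rr_scale (b * c) x.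
Proof. by rewrite /rr_scale -mulrA -rmorphM. Qed.
Lemma rr_scale1 : left_id 1 rr_scale.
Proof. by move=> x; rewrite /rr_scale rmorph1 mulr1. Qed.
Lemma rr_scaleDr : right_distributive rr_scale +%R.
Proof. by move=> b x y; rewrite /rr_scale mulrDl. Qed.
Lemma rr_scaleDl x : {morph rr_scale^~ x : b c / b + c}.
Proof. by move=> b c; rewrite /rr_scale rmorphD mulrDr. Qed.

HB.instance Definition _ := GRing.Zmodule_isLmodule.Build B^c right_regular
  rr_scaleA rr_scale1 rr_scaleDr rr_scaleDl.

Definition res_scalars (_ : B -> A) (N : lmodType A) : Type := N.

Section Restrict.
Variable N : lmodType A.

HB.instance Definition _ := GRing.Zmodule.on (res_scalars f N).

Definition res_scalars_scale (b : B) (x : res_scalars f N) : res_scalars f N :=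
  f b *: (x : N).

Lemma res_scalars_scaleA b c x :
  res_scalars_scale b (res_scalars_scale c x) = res_scalars_scale (b * c) x.
Proof. by rewrite /res_scalars_scale scalerA -rmorphM. Qed.
Lemma res_scalars_scale1 : left_id 1 res_scalars_scale.
Proof. by move=> x; rewrite /res_scalars_scale rmorph1 scale1r. Qed.
Lemma res_scalars_scaleDr : right_distributive res_scalars_scale +%R.
Proof. by move=> b x y; rewrite /res_scalars_scale scalerDr. Qed.
Lemma res_scalars_scaleDl x : {morph res_scalars_scale^~ x : b c / b + c}.
Proof. by move=> b c; rewrite /res_scalars_scale rmorphD scalerDl. Qed.

HB.instance Definition _ := GRing.Zmodule_isLmodule.Build B (res_scalars f N)
  res_scalars_scaleA res_scalars_scale1 res_scalars_scaleDr res_scalars_scaleDl.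

End Restrict.

Definition left_mul (a : A) : right_regular -> right_regular :=
  fun x => a * (x : A).

Lemma lmul_linear a : linear (left_mul a).
Proof. by move=> b x y; rewrite /left_mul mulrDr mulrA. Qed.

HB.instance Definition _ a := GRing.isLinear.Build B^c right_regular
  right_regular _ (left_mul a) (lmul_linear a).

(* The induced module A (x)_B M, with A acting on the left factor. *)
Section Induced.
Variable M : lmodType B.

Definition induced : Type := tensor right_regular M.

HB.instance Definition _ := GRing.Zmodule.on induced.

Definition induced_scale (a : A) : induced -> induced :=
  tensor_map (left_mul a) idfun.

Lemma induced_scale_tens a x (m : M) :
  induced_scale a (tens (x : right_regular) m) =
  tens (a * (x : A) : right_regular) m.
Proof. exact: tensor_map_tens. Qed.

Lemma induced_scaleDr : right_distributive induced_scale +%R.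
Proof. by move=> a s t; rewrite [LHS](raddfD (tensor_map (left_mul a) idfun)). Qed.

Lemma induced_scaleA a b t :
  induced_scale a (induced_scale b t) = induced_scale (a * b) t.
Proof.
elim/tensor_ind: t => [|x m|s t IHs IHt].
- by rewrite /induced_scale !raddf0.
- by rewrite !induced_scale_tens mulrA.
- by rewrite !induced_scaleDr IHs IHt.
Qed.

Lemma induced_scale1 : left_id 1 induced_scale.
Proof.
elim/tensor_ind => [|x m|s t IHs IHt]; first by rewrite /induced_scale raddf0.
  by rewrite induced_scale_tens mul1r.
by rewrite induced_scaleDr IHs IHt.
Qed.

Lemma induced_scaleDl t : {morph induced_scale^~ t : a b / a + b}.
Proof.
move=> a b; elim/tensor_ind: t => [|x m|s t IHs IHt].
- by rewrite /induced_scale !raddf0 addr0.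
- by rewrite !induced_scale_tens mulrDl -tensDl.
- by rewrite !induced_scaleDr IHs IHt addrACA.
Qed.

HB.instance Definition _ := GRing.Zmodule_isLmodule.Build A induced
  induced_scaleA induced_scale1 induced_scaleDr induced_scaleDl.

End Induced.

Section Separable.

Definition right_mul (a : A) : res_scalars f A^o -> res_scalars f A^o :=
  fun x => (x : A) * a.

Lemma rmul_linear a : linear (right_mul a).
Proof.
by move=> b x y; rewrite /right_mul mulrDl -[b *: x]/(f b * (x : A)) -mulrA.
Qed.

HB.instance Definition _ a := GRing.isLinear.Build B (res_scalars f A^o)
  (res_scalars f A^o) _ (right_mul a) (rmul_linear a).

(* A (x)_B A; its left A-action is that of an induced module. *)
Definition tensor_square : lmodType A := induced (res_scalars f A^o).

Definition square_rscale (a : A) : tensor_square -> tensor_square :=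
  tensor_map (idfun : {linear right_regular -> right_regular}) (right_mul a).

Definition square_mul : tensor_square -> A :=
  tensor_lift (fun (x : right_regular) (y : res_scalars f A^o) =>
    (x : A) * (y : A)).

Lemma square_mul_tens (x y : A) :
  square_mul (tens (x : right_regular) (y : res_scalars f A^o)) = x * y.
Proof.
apply: tensor_lift_tens => [x1 x2 z|z x1 x2|z b t].
- by rewrite mulrDl.
- by rewrite mulrDr.
- by rewrite -[RHS]/((z : A) * (f b * (t : A))) mulrA.
Qed.

(* A is a separable extension of B: the multiplication map has a section      *)
(* which is a map of A-A-bimodules.                                           *)
Definition separable_extension : Prop :=
  exists s : A -> tensor_square,
    [/\ forall a b, s (a + b) = s a + s b,
        forall a b, s (a * b) = a *: s b,
        forall a b, s (b * a) = square_rscale a (s b)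
      & forall a, square_mul (s a) = a].

Lemma square_rscale_tens (a x y : A) :
  square_rscale a (tens (x : right_regular) (y : res_scalars f A^o)) =
  tens (x : right_regular) (y * a : res_scalars f A^o).
Proof. exact: tensor_map_tens. Qed.

Lemma square_mul_zmod : zmod_morphism square_mul.
Proof.
apply: tensor_lift_zmod => [x1 x2 z|z x1 x2|z b t].
- by rewrite mulrDl.
- by rewrite mulrDr.
- by rewrite -[RHS]/((z : A) * (f b * (t : A))) mulrA.
Qed.

HB.instance Definition _ := GRing.isZmodMorphism.Build _ _ square_mul
  square_mul_zmod.

Lemma square_rscale_zmod a : zmod_morphism (square_rscale a).
Proof. exact: tensor_map_zmod. Qed.

HB.instance Definition _ a := GRing.isZmodMorphism.Build _ _ (square_rscale a)
  (square_rscale_zmod a).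

Lemma square_ind (P : tensor_square -> Prop) : P 0 ->
  (forall x y : A, P (tens (x : right_regular) (y : res_scalars f A^o))) ->
  (forall s t, P s -> P t -> P (s + t)) -> forall t, P t.
Proof. by move=> P0 Pt PD; apply: tensor_ind. Qed.

Lemma separable_extensionP : separable_extension <->
  exists r : seq (A * A),
    (forall a : A,
       \sum_(p <- r) tens (p.1 : right_regular) (p.2 * a : res_scalars f A^o) =
       \sum_(p <- r) tens (a * p.1 : right_regular) (p.2 : res_scalars f A^o))
    /\ \sum_(p <- r) p.1 * p.2 = 1.
Proof.
have rsum a (r : seq (A * A)) : square_rscale a (\sum_(p <- r)
    tens (p.1 : right_regular) (p.2 : res_scalars f A^o)) =
  \sum_(p <- r) tens (p.1 : right_regular) (p.2 * a : res_scalars f A^o).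
  rewrite [LHS]raddf_sum.
  by apply: eq_bigr => p _; exact: square_rscale_tens.
have lsum a (r : seq (A * A)) : a *: ((\sum_(p <- r)
    tens (p.1 : right_regular) (p.2 : res_scalars f A^o)) : tensor_square) =
  \sum_(p <- r) tens (a * p.1 : right_regular) (p.2 : res_scalars f A^o).
  rewrite [LHS](raddf_sum (tensor_map (left_mul a) idfun)).
  by apply: eq_bigr => p _; exact: induced_scale_tens.
have musum (r : seq (A * A)) : square_mul (\sum_(p <- r)
    tens (p.1 : right_regular) (p.2 : res_scalars f A^o)) =
  \sum_(p <- r) p.1 * p.2.
  by rewrite raddf_sum; apply: eq_bigr => p _; exact: square_mul_tens.
split=> [[s [_ sl sr smul]]|[r [rC r1]]].
  have [r rE] : exists r : seq (A * A), s 1 = \sum_(p <- r)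
      tens (p.1 : right_regular) (p.2 : res_scalars f A^o).
    elim/tensor_ind: (s 1) => [|e m|t1 t2 [r1 ->] [r2 ->]].
    - by exists [::]; rewrite big_nil.
    - by exists [:: (e : A, m : A)]; rewrite big_seq1.
    - by exists (r1 ++ r2); rewrite big_cat.
  exists r; split=> [a|]; last by rewrite -musum -rE smul.
  transitivity (s a); first by rewrite -rsum -rE -sr mul1r.
  by rewrite -[a in LHS]mulr1 sl rE; exact: lsum.
pose c : tensor_square :=
  \sum_(p <- r) tens (p.1 : right_regular) (p.2 : res_scalars f A^o).
have cC a : square_rscale a c = a *: c.
  by rewrite [LHS]rsum rC; apply/esym/lsum.
exists (fun a => a *: c); split=> [a b|a b|a b|a].
- by rewrite scalerDl.
- by rewrite scalerA.
- rewrite -scalerA -cC.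
  elim/square_ind: c {cC} => [|x y|t1 t2 IH1 IH2].
  + by rewrite (raddf0 (square_rscale a)) !scaler0 raddf0.
  + apply: etrans (congr1 (GRing.scale b) (square_rscale_tens a x y)) _.
    apply: etrans (induced_scale_tens b x _) _.
    apply: etrans (esym (square_rscale_tens a (b * x) y)) _.
    by congr square_rscale; apply/esym/induced_scale_tens.
  + by rewrite (raddfD (square_rscale a)) !scalerDr raddfD IH1 IH2.
- rewrite -[RHS]mulr1 -r1 -musum -/c.
  elim/square_ind: c {cC} => [|x y|t1 t2 IH1 IH2].
  + by rewrite scaler0 raddf0 mulr0.
  + apply: etrans (congr1 square_mul (induced_scale_tens a x _)) _.
    by rewrite !square_mul_tens mulrA.
  + rewrite scalerDr !(raddfD square_mul) mulrDr.
    by congr (_ + _); [exact: IH1 | exact: IH2].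
Qed.

End Separable.
End ChangeOfRings.

Section Homological.
Variable A : pzRingType.

Section LinearKernel.
Variables (U V : lmodType A) (f : {linear U -> V}).

Definition lker_pred : {pred U} := fun x => f x == 0.

Lemma lker_submod : submod_closed lker_pred.
Proof.
split=> [|a u v]; first by rewrite unfold_in /lker_pred linear0.
rewrite !unfold_in /lker_pred => /eqP fu /eqP fv.
by rewrite linearP fu fv scaler0 addr0.
Qed.

HB.instance Definition _ := GRing.isSubmodClosed.Build A U lker_pred lker_submod.

Record linker := LinKer { linker_val :> U; _ : linker_val \in lker_pred }.

HB.instance Definition _ := [isSub for linker_val].
HB.instance Definition _ := [Choice of linker by <:].
HB.instance Definition _ := [SubChoice_isSubLmodule of linker by <:].

End LinearKernel.

Section Hom.
Variables (U V : lmodType A).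

Definition hom_pred : {pred U -> V} := fun f => `[< linear f >].

Lemma hom_zmod : zmod_closed hom_pred.
Proof.
split=> [|f g /asboolP lf /asboolP lg]; apply/asboolP => a x y.
  by rewrite -![(0 : U -> V) _]/(0 : V) scaler0 addr0.
rewrite -![(f - g) _]/(f _ - g _) lf lg scalerBr opprD.
by rewrite addrACA.
Qed.

HB.instance Definition _ := GRing.isZmodClosed.Build (U -> V) hom_pred hom_zmod.

Record lhom := LHom { hom_val :> U -> V; _ : hom_val \in hom_pred }.

HB.instance Definition _ := [isSub for hom_val].
HB.instance Definition _ := [Choice of lhom by <:].
HB.instance Definition _ := [SubChoice_isSubZmodule of lhom by <:].

Lemma hom_linear (f : lhom) : linear f.
Proof. by case: f => f /= /asboolP. Qed.

End Hom.

Section Precomp.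
Variables (U W V : lmodType A) (d : {linear W -> U}).

Lemma precomp_subproof (f : lhom U V) : (f \o d : W -> V) \in @hom_pred W V.
Proof. by apply/asboolP => a x y; rewrite /= linearP hom_linear. Qed.

Definition precomp (f : lhom U V) : lhom W V := LHom (precomp_subproof f).

Lemma precomp_zmod : zmod_morphism precomp.
Proof. by move=> f g; apply: val_inj; apply/funext. Qed.

HB.instance Definition _ := GRing.isZmodMorphism.Build _ _ precomp precomp_zmod.

End Precomp.
End Homological.

Section Homology.
Variables (U V W : zmodType) (f : {additive U -> V}) (g : {additive V -> W}).

Definition zker_pred : {pred V} := fun x => g x == 0.

Lemma zker_zmod : zmod_closed zker_pred.
Proof.
split=> [|u v]; first by rewrite unfold_in /zker_pred raddf0.
rewrite !unfold_in /zker_pred => /eqP gu /eqP gv.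
by rewrite raddfB gu gv subr0.
Qed.

HB.instance Definition _ := GRing.isZmodClosed.Build V zker_pred zker_zmod.

Record zker := ZKer { zker_val :> V; _ : zker_val \in zker_pred }.

HB.instance Definition _ := [isSub for zker_val].
HB.instance Definition _ := [Choice of zker by <:].
HB.instance Definition _ := [SubChoice_isSubZmodule of zker by <:].

Definition boundary_pred : {pred zker} :=
  fun x => `[< exists u, f u = zker_val x >].

Lemma boundary_zmod : zmod_closed boundary_pred.
Proof.
split=> [|x y /asboolP[u fu] /asboolP[v fv]]; apply/asboolP.
  by exists 0; rewrite raddf0.
by exists (u - v); rewrite raddfB fu fv.
Qed.

HB.instance Definition _ := GRing.isZmodClosed.Build zker boundary_pred
  boundary_zmod.

(* Homology ker g / im f of U -f-> V -g-> W at V. *)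
Definition homology := Quotient.quot boundary_pred.

HB.instance Definition _ := GRing.Zmodule.on homology.

End Homology.

Section DerivedFunctors.
Variable A : pzRingType.

(* The canonical free resolution                                              *)
(*   ... -> free_res X 1 -> free_res X 0 -> X -> 0:                           *)
(* free_res X n is free on the elements of the n-th syzygy of X.              *)
Definition augment (X : lmodType A) : free_mod A X -> X := free_lift (@id X).

HB.instance Definition _ (X : lmodType A) := GRing.Linear.on (@augment X).

Fixpoint syzygy (X : lmodType A) (n : nat) : lmodType A :=
  if n is n'.+1 then linker (@augment (syzygy X n')) else X.

Definition free_res (X : lmodType A) (n : nat) : lmodType A :=
  free_mod A (syzygy X n).

Definition free_diff (X : lmodType A) (n : nat) :
    free_res X n.+1 -> free_res X n :=
  fun x => linker_val (@augment (syzygy X n.+1) x).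

Lemma free_diff_linear X n : linear (@free_diff X n).
Proof. by move=> a x y; rewrite /free_diff linearP. Qed.

HB.instance Definition _ X n := GRing.isLinear.Build A (free_res X n.+1)
  (free_res X n) _ (@free_diff X n) (@free_diff_linear X n).

Lemma augment_surj (X : lmodType A) (x : X) : exists y, @augment X y = x.
Proof. by exists (free_basis x); exact: free_lift_basis. Qed.

Lemma free_diff_exact0 (X : lmodType A) (x : free_res X 0) :
  @augment X x = 0 <-> exists y, @free_diff X 0 y = x.
Proof.
split=> [/eqP x0|[y <-]]; last first.
  by apply/eqP; exact: (valP (augment y)).
have [y yE] := @augment_surj (syzygy X 1) (LinKer x0).
by exists y; rewrite /free_diff yE.
Qed.

Lemma free_diff_exact (X : lmodType A) n (x : free_res X n.+1) :
  @free_diff X n x = 0 <-> exists y, @free_diff X n.+1 y = x.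
Proof.
apply: iff_trans (@free_diff_exact0 (syzygy X n.+1) x).
by split=> [x0|x0]; [apply: val_inj | rewrite /free_diff x0].
Qed.

(* Ext^n_A(X, Y), for left modules X and Y. *)
Definition Ext (n : nat) (X Y : lmodType A) : zmodType :=
  if n is n'.+1 then
    homology (@precomp A (free_res X n') (free_res X n'.+1) Y (@free_diff X n'))
      (@precomp A (free_res X n'.+1) (free_res X n'.+2) Y (@free_diff X n'.+1))
  else
    homology (\0 : {additive int -> lhom (free_res X 0) Y})
      (@precomp A (free_res X 0) (free_res X 1) Y (@free_diff X 0)).

(* Tor_n^A(X, Y), for a right module X and a left module Y. *)
Definition Tor (n : nat) (X : lmodType A^c) (Y : lmodType A) : zmodType :=
  if n is n'.+1 then
    homology
      (tensor_map (idfun : {linear X -> X}) (@free_diff Y n'.+1))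
      (tensor_map (idfun : {linear X -> X}) (@free_diff Y n'))
  else
    homology (tensor_map (idfun : {linear X -> X}) (@free_diff Y 0))
      (\0 : {additive tensor X (free_res Y 0) -> int}).

End DerivedFunctors.

Definition injective_module (A : pzRingType) (E : lmodType A) : Prop :=
  forall (X Y : lmodType A) (i : {linear X -> Y}) (f : {linear X -> E}),
    injective i -> exists g : {linear Y -> E}, forall x, g (i x) = f x.

(* The least n satisfying P, or +oo if there is none. *)
Definition least_or_oo (P : nat -> Prop) : \bar int :=
  if pselect (exists n, `[< P n >]) is left ex then ((ex_minn ex)%:Z)%:E
  else +oo%E.

Definition copure_inj_dim (A : pzRingType) (M : lmodType A) : \bar int :=
  least_or_oo (fun n => forall E : lmodType A, injective_module E ->
    forall i, (1 <= i)%N -> forall x : Ext (n + i) E M, x = 0).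

Definition copure_flat_dim (A : pzRingType) (M : lmodType A) : \bar int :=
  least_or_oo (fun n => forall E : lmodType A^c, injective_module E ->
    forall i, (1 <= i)%N -> forall x : Tor (n + i) E M, x = 0).

(* Each ring_act g is bijective, with inverse ring_act g^-1. *)
Record ring_action (G : finGroupType) (R : pzRingType) := RingAction {
  ring_act :> G -> {rmorphism R -> R};
  ring_act1 : forall r, ring_act 1%g r = r;
  ring_actM : forall g h r, ring_act (g * h)%g r = ring_act g (ring_act h r)
}.

Section SkewGroupRing.
Variables (G : finGroupType) (R : pzRingType) (act : ring_action G R).

(* a : skew_ring act stands for \sum_g (a g) g. *)
Definition skew_ring (_ : ring_action G R) : Type := {ffun G -> R}.

HB.instance Definition _ := GRing.Zmodule.on (skew_ring act).

Implicit Types a b c : skew_ring act.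

Definition skew_one : skew_ring act := [ffun g => (g == 1%g)%:R].

(* The coefficient of k in (\sum_g (a g) g) (\sum_h (b h) h), using           *)
(* (r g) (s h) = r g(s) (g h).                                                *)
Definition skew_mul a b : skew_ring act :=
  [ffun k => \sum_g a g * act g (b (g^-1 * k)%g)].

Lemma skew_mulA : associative skew_mul.
Proof.
move=> a b c; apply/ffunP => k; rewrite !ffunE.
under eq_bigr => g _ do rewrite ffunE rmorph_sum mulr_sumr.
under [RHS]eq_bigr => g _ do rewrite ffunE mulr_suml.
rewrite [RHS]exchange_big /=; apply: eq_bigr => g _.
rewrite [RHS](reindex_inj (mulgI g)) /=; apply: eq_bigr => h _.
by rewrite mulKg rmorphM mulrA ring_actM invMg mulgA.
Qed.

Lemma skew_mul1r : left_id skew_one skew_mul.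
Proof.
move=> a; apply/ffunP => k; rewrite ffunE (bigD1 1%g) //= big1 => [|g].
  by rewrite ffunE eqxx mul1r ring_act1 invg1 mul1g addr0.
by rewrite ffunE => /negbTE ->; rewrite mul0r.
Qed.

Lemma skew_mulr1 : right_id skew_one skew_mul.
Proof.
move=> a; apply/ffunP => k; rewrite ffunE (bigD1 k) //= big1 => [|g gk].
  by rewrite ffunE mulVg eqxx rmorph1 mulr1 addr0.
rewrite ffunE -eq_mulVg1 [g == k]eq_sym eq_sym (negbTE gk).
by rewrite rmorph0 mulr0.
Qed.

Lemma skew_mulDl : left_distributive skew_mul +%R.
Proof.
move=> a b c; apply/ffunP => k; rewrite !ffunE -big_split /=.
by apply: eq_bigr => g _; rewrite ffunE mulrDl.
Qed.

Lemma skew_mulDr : right_distributive skew_mul +%R.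
Proof.
move=> a b c; apply/ffunP => k; rewrite !ffunE -big_split /=.
by apply: eq_bigr => g _; rewrite ffunE rmorphD mulrDr.
Qed.

HB.instance Definition _ := GRing.Zmodule_isPzRing.Build (skew_ring act)
  skew_mulA skew_mul1r skew_mulr1 skew_mulDl skew_mulDr.

(* The element r g of RG. *)
Definition skew_mono (r : R) (g : G) : skew_ring act :=
  [ffun k => if k == g then r else 0].

Lemma skew_monoM r s g h :
  skew_mono r g * skew_mono s h = skew_mono (r * act g s) (g * h)%g.
Proof.
apply/ffunP => k; rewrite ffunE (bigD1 g) //= big1 => [|g' /negbTE g'g].
  rewrite !ffunE eqxx addr0 -(inj_eq (mulgI g)) mulKVg.
  by case: ifP; rewrite ?rmorph0 ?mulr0.
by rewrite ffunE g'g mul0r.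
Qed.

End SkewGroupRing.

Section Subgroup.
Variables (G : finGroupType) (R : pzRingType) (act : ring_action G R).
Variable H : {group G}.

Definition sub_action : ring_action (subg_of H) R :=
  @RingAction (subg_of H) R (fun h => act (sgval h)) (ring_act1 act)
    (fun g h => ring_actM act (sgval g) (sgval h)).

(* The inclusion of RH in RG: extension by 0 outside H. *)
Definition skew_incl (a : skew_ring sub_action) : skew_ring act :=
  [ffun g => if g \in H then a (subg H g) else 0].

Lemma skew_incl_zmod : zmod_morphism skew_incl.
Proof.
move=> a b; apply/ffunP => g; rewrite !ffunE.
by case: ifP; rewrite ?subr0.
Qed.

Lemma skew_incl_monoid : monoid_morphism skew_incl.
Proof.
split=> [|a b]; apply/ffunP => k; rewrite [LHS]ffunE [RHS]ffunE.
  rewrite ffunE; case: ifPn => kH; last first.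
    by case: (k =P 1%g) kH => // ->; rewrite group1.
  by rewrite -(inj_eq (@subg_inj _ H)) subgK.
rewrite [RHS](bigID (mem H)) /= [X in _ + X]big1 ?addr0 => [|g gH]; last first.
  by rewrite ffunE (negbTE gH) mul0r.
case: ifPn => kH; last first.
  rewrite big1 // => g gH.
  by rewrite [X in act g X]ffunE groupMl ?groupV // (negbTE kH) rmorph0 mulr0.
rewrite ffunE [RHS](reindex_onto sgval (subg H)) /= => [|g gH]; last first.
  exact: subgK.
apply: eq_big => [h|h _]; first by rewrite subgP sgvalK eqxx.
rewrite !ffunE subgP groupM ?groupV ?subgP // sgvalK; congr (_ * act _ (b _)).
by apply: subg_inj; rewrite /= !subgK ?groupM ?groupV ?subgP.
Qed.

HB.instance Definition _ := GRing.isZmodMorphism.Build _ _ skew_incl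
  skew_incl_zmod.
HB.instance Definition _ := GRing.isMonoidMorphism.Build _ _ skew_incl
  skew_incl_monoid.

End Subgroup.

(* Main.v *)
Require Import Defs.
From HB Require Import structures.
From mathcomp Require Import all_boot all_order all_fingroup all_algebra.
From mathcomp Require Import boolp classical_sets functions cardinality fsbigop.
From mathcomp Require Import constructive_ereal finmap.

(* RG is a Frobenius extension of RH: restriction of coefficients to H is an  *)
(* RH-bimodule retraction p of RG onto RH, and the elements g, g^-1, for g    *)
(* running over left coset representatives, are dual bases for p. Hence       *)
(* induction is both left and right adjoint to restriction, so both functors  *)
(* preserve injectives and projective resolutions, which gives the Shapiro    *)
(* isomorphisms Ext_RH(E, N|) = Ext_RG(E^, N), Ext_RG(E, M^) = Ext_RH(E|, M)  *)
(* and their analogues for Tor. So restriction and induction do not increase  *)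
(* the copure dimensions. As p retracts, M is a direct summand of M^|, and N  *)
(* is one of N|^ when the extension is separable: this gives the equalities.  *)

Import Order.TTheory GRing.Theory.
Local Open Scope ring_scope.

Set Implicit Arguments.
Unset Strict Implicit.
Unset Printing Implicit Defensive.

(** The argument works for any ring map [f : B -> A] with [frobenius f]; skew group rings enter only
    through [skew_frobenius]. Write Ind and Res for induction and restriction along f.

    Only vanishing matters. Ext^(n+1) vanishes when every map on the (n+1)-st syzygy extends to the
    projective module containing it, and Tor_(n+1) when tensoring keeps that syzygy inclusion
    injective ([Ext_eq0P], [Tor_eq0P]). Both conditions pass to retracts of the resolved module, in
    particular from one resolution to another ([ext_vanishes_retract], [tor_vanishes_retract]), so
    an induced or restricted free resolution may stand in for the canonical one.

    For Ext, the two adjunctions transpose extension problems between A and B. For Tor, the natural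
    maps relating Ind E ⊗_A N to E ⊗_B Res N, and E ⊗_A Ind M to Res E ⊗_B M, transport injectivity.
    As both functors preserve injectives, neither one increases a copure dimension.

    Conversely M is a retract of Res (Ind M) ([induced_unitK]), so dim M <= dim Res (Ind M) <= dim
    Ind M. In the separable case N is a retract of Ind (Res N) ([separable_retract]), so dim N <=
    dim Ind (Res N) = dim Res N. *)

Section LinearMaps.
Variable A : pzRingType.
Implicit Types U V W : lmodType A.

Definition lin_of U V (f : U -> V) (_ : linear f) : U -> V := f.
HB.instance Definition _ U V (f : U -> V) (lf : linear f) :=
  GRing.isLinear.Build A U V _ (lin_of lf) lf.

Lemma linear_factor U V W (f : {linear U -> V}) (i : {linear W -> V}) :
  injective i -> (forall x, exists y, i y = f x) ->
  exists g : {linear U -> W}, forall x, i (g x) = f x.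
Proof.
move=> inji /boolp.choice[g gE].
have lg : linear g by move=> a x y; apply: inji; rewrite linearP !gE linearP.
by exists (lin_of lg).
Qed.

(** * Projective modules, projective resolutions and their comparison *)

Definition projective_module (P : lmodType A) : Prop :=
  forall U V (e : {linear U -> V}) (f : {linear P -> V}),
    (forall y, exists x, e x = y) -> exists g : {linear P -> U}, forall x, e (g x) = f x.

Lemma free_mod_projective (T : choiceType) : projective_module (free_mod A T).
Proof.
move=> U V e f /boolp.choice[s sE].
exists (free_lift (fun t => s (f (free_basis t)))) => x.
pose b (t : T) := f (free_basis t).
rewrite (@free_lift_uniq _ _ _ b f) // -(@free_lift_uniq _ _ _ b (e \o free_lift (s \o b))) //.
by move=> t /=; rewrite free_lift_basis sE.
Qed.

(* A projective resolution of [om 0], cut into the short exact sequences      *)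
(* 0 -> om n.+1 -> pr n -> om n -> 0.                                         *)
Record proj_resolution := ProjResolution {
  om : nat -> lmodType A;
  pr : nat -> lmodType A;
  inc : forall n, {linear om n.+1 -> pr n};
  epi : forall n, {linear pr n -> om n};
  inc_inj : forall n, injective (inc n);
  epi_surj : forall n y, exists x, epi n x = y;
  epi_inc : forall n x, epi n (inc n x) = 0;
  epi_ker : forall n x, epi n x = 0 -> exists y, inc n y = x;
  pr_projective : forall n, projective_module (pr n)
}.

Arguments inc : clear implicits.
Arguments epi : clear implicits.

Section Comparison.
Variables C D : proj_resolution.

Lemma proj_resolution_lift n (u : {linear om C n -> om D n}) :
  exists (v : {linear pr C n -> pr D n}) (u' : {linear om C n.+1 -> om D n.+1}),
    (forall x, epi D n (v x) = u (epi C n x)) /\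
    (forall x, inc D n (u' x) = v (inc C n x)).
Proof.
have [v vE] := @pr_projective C n _ _ (epi D n) (u \o epi C n) (@epi_surj D n).
have [u' u'E] : exists u' : {linear om C n.+1 -> om D n.+1},
    forall x, inc D n (u' x) = (v \o inc C n) x.
  apply: linear_factor; first exact: inc_inj.
  by move=> x; apply: epi_ker; rewrite /= vE /= epi_inc raddf0.
by exists v, u'.
Qed.

End Comparison.

Variables C D : proj_resolution.
Variables (u0 : {linear om C 0 -> om D 0}) (w0 : {linear om D 0 -> om C 0}).
Hypothesis w0u0 : cancel u0 w0.

(* The hypothesis says that id - w u factors through epi; one step later      *)
(* id - w' u' factors through inc, hence through the projective pr C n and    *)
(* again through epi.                                                         *)
Lemma retract_step n (u : {linear om C n -> om D n}) (w : {linear om D n -> om C n})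
    (t : {linear om C n -> pr C n}) :
    (forall x, x - w (u x) = epi C n (t x)) ->
  exists (u' : {linear om C n.+1 -> om D n.+1}) (v : {linear pr C n -> pr D n})
    (w' : {linear om D n.+1 -> om C n.+1}) (s : {linear pr C n -> om C n.+1}),
    (forall x, inc D n (u' x) = v (inc C n x)) /\
    (forall x, x - w' (u' x) = s (inc C n x)).
Proof.
move=> tE; have [v [u' [vE u'E]]] := proj_resolution_lift u.
have [v' [w' [v'E w'E]]] := proj_resolution_lift w.
(* By [tE], epi kills what remains of 1 - v'v after removing the homotopy t, so d factors through
   inc as s; on the image of inc the t term drops out. *)
pose d : {linear pr C n -> pr C n} := (idfun \- (v' \o v)) \- (t \o epi C n).
have [s sE] : exists s : {linear pr C n -> om C n.+1}, forall x, inc C n (s x) = d x.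
  apply: linear_factor => [|x]; first exact: inc_inj.
  by apply: epi_ker; rewrite !linearB /= v'E vE -tE subrr.
exists u', v, w', s; split=> // x; apply: (@inc_inj C n).
by rewrite sE [LHS]linearB /= w'E u'E /= epi_inc raddf0 subr0.
Qed.

(** A retraction lifts to a retraction up to homotopy. The induction carries the homotopy t, zero at
    the start and rebuilt at each stage by lifting s through the next epi. *)
Lemma resolution_retract n :
  exists (u : {linear om C n.+1 -> om D n.+1}) (v : {linear pr C n -> pr D n})
    (w : {linear om D n.+1 -> om C n.+1}) (s : {linear pr C n -> om C n.+1}),
    (forall x, inc D n (u x) = v (inc C n x)) /\
    (forall x, x - w (u x) = s (inc C n x)).
Proof.
suff [u [w [t tE]]] : exists (u : {linear om C n -> om D n})
    (w : {linear om D n -> om C n}) (t : {linear om C n -> pr C n}),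
    forall x, x - w (u x) = epi C n (t x) by exact: retract_step tE.
elim: n => [|n [u [w [t /retract_step[u' [v [w' [s [_ sE]]]]]]]]].
  by exists u0, w0, \0 => x; rewrite w0u0 subrr raddf0.
have [t' t'E] := @pr_projective C n _ _ (epi C n.+1) s (@epi_surj C n.+1).
by exists u', w', (t' \o inc C n) => x; rewrite sE /= t'E.
Qed.

End LinearMaps.

Definition additive_of (U V : zmodType) (f : U -> V) (_ : zmod_morphism f) : U -> V := f.
HB.instance Definition _ (U V : zmodType) (f : U -> V) (af : zmod_morphism f) :=
  GRing.isZmodMorphism.Build U V (additive_of af) af.

Lemma tensor_lift_exists (A : pzRingType) (X : lmodType A^c) (Y : lmodType A)
    (V : zmodType) (b : X -> Y -> V) :
    (forall x x' y, b (x + x') y = b x y + b x' y) ->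
    (forall x y y', b x (y + y') = b x y + b x y') ->
    (forall x (a : A) y, b ((a : A^c) *: x) y = b x (a *: y)) ->
  exists g : {additive tensor X Y -> V}, forall x y, g (tens x y) = b x y.
Proof.
move=> bDl bDr bM; exists (additive_of (tensor_lift_zmod bDl bDr bM)) => x y.
exact: tensor_lift_tens.
Qed.

(** * Vanishing of Ext and Tor read off from the syzygies *)

Section FreeResolution.
Variable A : pzRingType.

Definition free_inc (X : lmodType A) n : syzygy X n.+1 -> free_res X n :=
  fun x => linker_val (x : linker (@augment A (syzygy X n))).

Lemma free_inc_linear (X : lmodType A) n : linear (@free_inc X n).
Proof. by []. Qed.

HB.instance Definition _ (X : lmodType A) n := GRing.isLinear.Build A
  (syzygy X n.+1) (free_res X n) _ (@free_inc X n) (@free_inc_linear X n).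

(** Kept transparent so that the composite of epi and inc is [free_diff] by conversion. *)
Definition free_resolution (X : lmodType A) : proj_resolution A.
Proof.
apply: (@ProjResolution A (syzygy X) (free_res X) (@free_inc X)
  (fun n => @augment A (syzygy X n))) => n.
- exact: val_inj.
- exact: augment_surj.
- by move=> x; apply/eqP; exact: (valP (x : linker (@augment A (syzygy X n)))).
- by move=> x /eqP x0; exists (@LinKer A _ _ (@augment A (syzygy X n)) x x0).
- exact: free_mod_projective.
Defined.

(** By dimension shifting this is Ext^(n+1)(om C 0, Y) = 0: the index is one below the degree. *)
Definition ext_vanishes (C : proj_resolution A) (n : nat) (Y : lmodType A) : Prop :=
  forall f : {linear om C n.+1 -> Y}, exists g : {linear pr C n -> Y},
    forall x, g (inc C n x) = f x.

(** Likewise this is Tor_(n+1)(X, om C 0) = 0. *)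
Definition tor_vanishes (X : lmodType A^c) (C : proj_resolution A) (n : nat) : Prop :=
  forall t, tensor_map (idfun : {linear X -> X}) (inc C n) t = 0 -> t = 0.

Lemma tens0r (X : lmodType A^c) (Y : lmodType A) (x : X) : tens x (0 : Y) = 0.
Proof. by apply: (addrI (tens x 0)); rewrite -tensDr !addr0. Qed.

Lemma tens0l (X : lmodType A^c) (Y : lmodType A) (y : Y) : tens (0 : X) y = 0.
Proof. by apply: (addrI (tens 0 y)); rewrite -tensDl !addr0. Qed.

Lemma tensor_map_comp (X : lmodType A^c) (U V W : lmodType A)
    (f : {linear U -> V}) (g : {linear V -> W}) (h : {linear U -> W}) :
  (forall x, g (f x) = h x) -> forall t,
  tensor_map (idfun : {linear X -> X}) g (tensor_map (idfun : {linear X -> X}) f t) =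
  tensor_map (idfun : {linear X -> X}) h t.
Proof.
move=> fgh t; elim/tensor_ind: t => [|x u|s t hs ht]; first by rewrite !raddf0.
  by rewrite !tensor_map_tens fgh.
by rewrite !raddfD /= hs ht.
Qed.

Lemma tensor_map0 (X : lmodType A^c) (U V : lmodType A) (f : {linear U -> V}) :
  (forall x, f x = 0) -> forall t, tensor_map (idfun : {linear X -> X}) f t = 0.
Proof.
move=> f0 t; elim/tensor_ind: t => [|x u|s t hs ht]; first by rewrite !raddf0.
  by rewrite tensor_map_tens f0 tens0r.
by rewrite raddfD /= hs ht addr0.
Qed.

Section Independence.
Variables C D : proj_resolution A.
Variables (u0 : {linear om C 0 -> om D 0}) (w0 : {linear om D 0 -> om C 0}).
Hypothesis w0u0 : cancel u0 w0.

(** Split f as f w u + f s inc: the second term visibly extends along inc, and the first does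
    because f w extends over D and v pulls the extension back. *)
Lemma ext_vanishes_retract n (Y : lmodType A) : ext_vanishes D n Y -> ext_vanishes C n Y.
Proof.
have [u [v [w [s [uE sE]]]]] := resolution_retract w0u0 n.
move=> DY f; have [g gE] := DY (f \o w).
exists ((g \o v) \+ (f \o s)) => x.
by rewrite /= -uE gE /= -sE linearB /= addrC subrK.
Qed.

Lemma tor_vanishes_retract n (X : lmodType A^c) : tor_vanishes X D n -> tor_vanishes X C n.
Proof.
have [u [v [w [s [uE sE]]]]] := resolution_retract w0u0 n.
move=> XD t t0.
pose I := (idfun : {linear X -> X}).
have ut : tensor_map I u t = 0.
  apply: XD.
  transitivity (tensor_map I v (tensor_map I (inc C n) t)); last by rewrite t0 raddf0.
  rewrite (tensor_map_comp (h := v \o inc C n)) //.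
  by rewrite (tensor_map_comp (h := v \o inc C n)).
have : t = tensor_map I w (tensor_map I u t) + tensor_map I s (tensor_map I (inc C n) t).
  elim/tensor_ind: t {t0 ut} => [|e m|t1 t2 h1 h2]; first by rewrite !raddf0 addr0.
    by rewrite !tensor_map_tens -tensDr -sE addrC subrK.
  by rewrite !raddfD /= {1}h1 {1}h2 addrACA.
by rewrite ut t0 !raddf0 addr0.
Qed.

End Independence.

Lemma homology_eq0P (U V W : zmodType) (f : {additive U -> V}) (g : {additive V -> W}) :
  (forall x : homology f g, x = 0) <-> (forall v, g v = 0 -> exists u, f u = v).
Proof.
have E (x : zker g) : (\pi_(homology f g) x = 0)%qT <-> exists u, f u = zker_val x.
  rewrite -[0 in X in X <-> _](raddf0 \pi_(homology f g)%qT).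
  split=> [/eqmodP|h]; last apply/eqmodP.
    by rewrite /= /Quotient.equiv subr0 => /asboolP.
  by rewrite /= /Quotient.equiv subr0; apply/asboolP.
split=> [h v gv|h x].
  have gv' : v \in zker_pred g by apply/eqP.
  by have [u uE] := (E (ZKer gv')).1 (h _); exists u.
rewrite -(generic_quotient.reprK x); apply/E; apply: h.
by case: (generic_quotient.repr x) => v /= /eqP.
Qed.

Lemma linear_cofactor (U V W : lmodType A) (f : {linear U -> V}) (e : {linear U -> W}) :
  (forall y, exists x, e x = y) -> (forall x, e x = 0 -> f x = 0) ->
  exists g : {linear W -> V}, forall x, g (e x) = f x.
Proof.
move=> /boolp.choice[s sE] fe.
have eqf x y : e x = e y -> f x = f y.
  move=> exy; apply/eqP; rewrite -subr_eq0 -linearB; apply/eqP/fe.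
  by rewrite linearB /= exy subrr.
have lg : linear (f \o s) by move=> a x y; rewrite /= -linearP; apply: eqf; rewrite linearP !sE.
by exists (lin_of lg) => x; apply: eqf; rewrite sE.
Qed.

(** Cocycles on pr C n.+1 are exactly the maps that descend to om C n.+1; such a cocycle is a
    coboundary when the descended map extends to pr C n. *)
Lemma ext_vanishesP (C : proj_resolution A) n (Y : lmodType A)
    (d2 : {linear pr C n.+2 -> pr C n.+1}) (d1 : {linear pr C n.+1 -> pr C n}) :
    (forall x, inc C n.+1 (epi C n.+2 x) = d2 x) ->
    (forall x, inc C n (epi C n.+1 x) = d1 x) ->
  (forall v : lhom (pr C n.+1) Y, precomp d2 v = 0 -> exists u, precomp d1 u = v) <->
  ext_vanishes C n Y.
Proof.
move=> d2E d1E; split=> h.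
  move=> f; have vP : (f \o epi C n.+1) \in @hom_pred A (pr C n.+1) Y.
    by apply/asboolP => a x y; rewrite /= !linearP.
  have [|u uE] := h (LHom vP).
    by apply: val_inj; apply/funext => x; rewrite /= -d2E epi_inc raddf0.
  exists (lin_of (hom_linear u)) => y; have [x <-] := epi_surj y.
  by rewrite d1E; exact: (congr1 (fun w : lhom _ _ => hom_val w x) uE).
move=> v v0; have [f fE] : exists f : {linear om C n.+1 -> Y},
    forall x, f (epi C n.+1 x) = lin_of (hom_linear v) x.
  apply: linear_cofactor => [|x /epi_ker[z <-]]; first exact: epi_surj.
  have [y <-] := epi_surj z; rewrite d2E.
  exact: (congr1 (fun w : lhom _ _ => hom_val w y) v0).
have [g gE] := h f.
have gP : (g : pr C n -> Y) \in @hom_pred A (pr C n) Y.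
  by apply/asboolP => a x y; rewrite linearP.
exists (LHom gP); apply: val_inj; apply/funext => x.
by rewrite -[RHS]fE -gE d1E.
Qed.

Lemma Ext_eq0P n (X Y : lmodType A) :
  (forall x : Ext n.+1 X Y, x = 0) <-> ext_vanishes (free_resolution X) n Y.
Proof.
apply: iff_trans (homology_eq0P _ _) _.
exact: (@ext_vanishesP (free_resolution X) n Y (@free_diff A X n.+1) (@free_diff A X n)).
Qed.

Section RightExact.
Variables (X : lmodType A^c) (K P M : lmodType A).
Variables (i : {linear K -> P}) (e : {linear P -> M}).
Hypothesis e_surj : forall y, exists x, e x = y.
Hypothesis e_ker : forall x, e x = 0 -> exists y, i y = x.

Local Notation T := (tensor_map (idfun : {linear X -> X}) i).

Definition tensor_im : {pred tensor X P} := fun t => `[< exists s, T s = t >].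

Lemma tensor_im_zmod : zmod_closed tensor_im.
Proof.
split=> [|x y /asboolP[u fu] /asboolP[v fv]]; apply/asboolP.
  by exists 0; rewrite raddf0.
by exists (u - v); rewrite raddfB /= fu fv.
Qed.

HB.instance Definition _ := GRing.isZmodClosed.Build _ tensor_im tensor_im_zmod.

Lemma tensor_right_exact (t : tensor X P) :
  tensor_map (idfun : {linear X -> X}) e t = 0 -> exists s, T s = t.
Proof.
have [s sE] := boolp.choice e_surj.
pose Q := Quotient.quot tensor_im.
pose q : {additive tensor X P -> Q} := \pi_Q%qT.
have q0 z : q z = 0 <-> exists s, T s = z.
  rewrite -(raddf0 q).
  split=> [/eqmodP|h]; last apply/eqmodP.
    by rewrite /= /Quotient.equiv subr0 => /asboolP.
  by rewrite /= /Quotient.equiv subr0; apply/asboolP.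
have qE x p p' : e p = e p' -> q (tens x p) = q (tens x p').
  move=> ee; have [k kE] : exists k, i k = p - p'.
    by apply: e_ker; rewrite linearB /= ee subrr.
  have -> : p = i k + p' by rewrite kE subrK.
  rewrite tensDr raddfD /= (_ : q _ = 0) ?add0r //; apply/q0.
  by exists (tens x k); rewrite tensor_map_tens.
(* A map back from X ⊗ M to the cokernel of 1 ⊗ i: by [qE] the class does not depend on the lift s
   m, which makes b biadditive and balanced although s is only a function. *)
pose b x m := q (tens x (s m)).
have bDl e1 e2 m : b (e1 + e2) m = b e1 m + b e2 m by rewrite /b tensDl raddfD.
have bDr x m1 m2 : b x (m1 + m2) = b x m1 + b x m2.
  by rewrite /b -raddfD -tensDr; apply: qE; rewrite linearD /= !sE.
have bM x (a : A) m : b ((a : A^c) *: x) m = b x (a *: m).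
  by rewrite /b tensM; apply: qE; rewrite linearZ /= !sE.
have [l lb] := tensor_lift_exists bDl bDr bM.
have lE z : l (tensor_map idfun e z) = q z.
  elim/tensor_ind: z => [|x p|z1 z2 h1 h2]; first by rewrite !raddf0.
    by rewrite tensor_map_tens lb; apply: qE; rewrite sE.
  by rewrite !raddfD /= h1 h2.
by move=> et; apply/q0; rewrite -lE et raddf0.
Qed.

End RightExact.

Lemma tensor_map_surj (X : lmodType A^c) (P M : lmodType A) (e : {linear P -> M}) :
  (forall y, exists x, e x = y) ->
  forall t, exists s, tensor_map (idfun : {linear X -> X}) e s = t.
Proof.
move=> e_surj; elim/tensor_ind => [|x m|_ _ [s1 <-] [s2 <-]].
- by exists 0; rewrite raddf0.
- by have [p <-] := e_surj m; exists (tens x p); rewrite tensor_map_tens.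
- by exists (s1 + s2); rewrite raddfD.
Qed.

(** By right exactness, 1 ⊗ epi is onto with kernel the image of 1 ⊗ d2; hence cycles modulo
    boundaries are the kernel of 1 ⊗ inc. *)
Lemma tor_vanishesP (X : lmodType A^c) (C : proj_resolution A) n
    (d2 : {linear pr C n.+2 -> pr C n.+1}) (d1 : {linear pr C n.+1 -> pr C n}) :
    (forall x, inc C n.+1 (epi C n.+2 x) = d2 x) ->
    (forall x, inc C n (epi C n.+1 x) = d1 x) ->
  (forall t, tensor_map (idfun : {linear X -> X}) d1 t = 0 ->
     exists s, tensor_map (idfun : {linear X -> X}) d2 s = t) <->
  tor_vanishes X C n.
Proof.
move=> d2E d1E; have es m := tensor_map_surj (X := X) (@epi_surj A C m).
split=> h t t0.
  have [s sE] := es _ t.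
  have [|u uE] := h s; first by rewrite -(tensor_map_comp d1E) sE.
  rewrite -sE -uE -(tensor_map_comp d2E).
  rewrite (tensor_map_comp (h := epi C n.+1 \o inc C n.+1)) // tensor_map0 //.
  exact: epi_inc.
have /h e0 : tensor_map (idfun : {linear X -> X}) (inc C n)
    (tensor_map (idfun : {linear X -> X}) (epi C n.+1) t) = 0.
  by rewrite (tensor_map_comp d1E).
have [s sE] := tensor_right_exact (@epi_surj A C n.+1) (@epi_ker A C n.+1) e0.
have [r rE] := es _ s.
by exists r; rewrite -(tensor_map_comp d2E) rE.
Qed.

Lemma Tor_eq0P n (X : lmodType A^c) (Y : lmodType A) :
  (forall x : Tor n.+1 X Y, x = 0) <-> tor_vanishes X (free_resolution Y) n.
Proof.
apply: iff_trans (homology_eq0P _ _) _.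
exact: (@tor_vanishesP X (free_resolution Y) n (@free_diff A Y n.+1) (@free_diff A Y n)).
Qed.

End FreeResolution.

(* A Frobenius extension f : B -> A split by a bimodule projection: fr_proj   *)
(* retracts A onto B and the pairs in fr_basis are dual bases for it.         *)
Record frobenius (A B : pzRingType) (f : {rmorphism B -> A}) := Frobenius {
  fr_proj : {additive A -> B};
  fr_basis : seq (A * A);
  fr_projMl : forall b a, fr_proj (f b * a) = b * fr_proj a;
  fr_projMr : forall a b, fr_proj (a * f b) = fr_proj a * b;
  fr_proj1 : fr_proj 1 = 1;
  fr_basisl : forall a, \sum_(q <- fr_basis) q.1 * f (fr_proj (q.2 * a)) = a;
  fr_basisr : forall a, \sum_(q <- fr_basis) f (fr_proj (a * q.1)) * q.2 = a
}.

(** * Induction as a left and right adjoint of restriction *)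

Section ScalarChange.
Variables (A B : pzRingType) (f : {rmorphism B -> A}).
Implicit Types (Z : lmodType B) (N : lmodType A).

Local Notation "a ⊗ z" := (tens (a : right_regular_along f) z) (at level 39).

Lemma res_scalarsE N (b : B) (x : res_scalars f N) : b *: x = (f b *: (x : N) : N).
Proof. by []. Qed.

Lemma induced_ind Z (P : (induced f Z : lmodType A) -> Prop) : P 0 ->
  (forall (a : A) z, P (a ⊗ z)) -> (forall s t, P s -> P t -> P (s + t)) ->
  forall t, P t.
Proof. by move=> P0 Pt PD; apply: tensor_ind. Qed.

Lemma induced_scaleE Z (a x : A) (z : Z) : a *: (x ⊗ z : induced f Z) = (a * x) ⊗ z.
Proof. exact: induced_scale_tens. Qed.

Lemma tens_scale Z (a : A) (b : B) (z : Z) : a ⊗ (b *: z) = (a * f b) ⊗ z.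
Proof. by rewrite -tensM. Qed.

Lemma tens_suml Z (I : Type) (s : seq I) (a : I -> A) (z : Z) :
  (\sum_(i <- s) a i) ⊗ z = \sum_(i <- s) a i ⊗ z.
Proof. by elim: s => [|i s IHs]; rewrite ?big_nil ?tens0l // !big_cons tensDl IHs. Qed.

Lemma tens_sumr Z (I : Type) (s : seq I) (a : A) (z : I -> Z) :
  a ⊗ (\sum_(i <- s) z i) = \sum_(i <- s) a ⊗ z i.
Proof. by elim: s => [|i s IHs]; rewrite ?big_nil ?tens0r // !big_cons tensDr IHs. Qed.

Lemma res_map_linear N N' (h : {linear N -> N'}) :
  linear (h : res_scalars f N -> res_scalars f N').
Proof. by move=> b x y; exact: (linearP h (f b) x y). Qed.

Definition res_map N N' (h : {linear N -> N'}) :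
    {linear res_scalars f N -> res_scalars f N'} := lin_of (res_map_linear h).

Lemma induced_additive_linear Z N (g : {additive induced f Z -> N}) :
  (forall (a c : A) z, g ((a * c) ⊗ z) = a *: g (c ⊗ z)) -> linear g.
Proof.
move=> gZ a x y; rewrite raddfD; congr (_ + _).
elim/induced_ind: x => [|c z|s t hs ht]; first by rewrite scaler0 raddf0 scaler0.
  by rewrite induced_scaleE gZ.
by rewrite (scalerDr a s t) !raddfD /= hs ht -scalerDr.
Qed.

Lemma induced_map_subproof Z Z' (h : {linear Z -> Z'}) :
  exists g : {linear induced f Z -> induced f Z'}, g =1 tensor_map idfun h.
Proof.
have ag : zmod_morphism (tensor_map idfun h : induced f Z -> induced f Z').
  exact: tensor_map_zmod.
pose g : {additive induced f Z -> induced f Z'} := additive_of ag.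
have gE (a : A) z : g (a ⊗ z) = a ⊗ h z by exact: tensor_map_tens.
have lg : linear g.
  by apply: induced_additive_linear => a c z; rewrite !gE induced_scaleE.
by exists (lin_of lg).
Qed.

Definition induced_map Z Z' (h : {linear Z -> Z'}) :
    {linear induced f Z -> induced f Z'} := projT1 (cid (induced_map_subproof h)).

Lemma induced_map_tensor Z Z' (h : {linear Z -> Z'}) : induced_map h =1 tensor_map idfun h.
Proof. exact: (projT2 (cid (induced_map_subproof h))). Qed.

Lemma induced_mapE Z Z' (h : {linear Z -> Z'}) (a : A) z :
  induced_map h (a ⊗ z) = a ⊗ h z.
Proof. by rewrite induced_map_tensor tensor_map_tens. Qed.

Lemma induced_unit_linear Z : linear ((fun z => 1 ⊗ z) : Z -> res_scalars f (induced f Z)).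
Proof.
move=> b x y; rewrite tensDr tens_scale mul1r; congr (_ + _).
by apply/esym/(etrans (induced_scaleE (f b) 1 x)); rewrite mulr1.
Qed.

Definition induced_unit Z : {linear Z -> res_scalars f (induced f Z)} :=
  lin_of (@induced_unit_linear Z).

Lemma induced_unitE Z (z : Z) : induced_unit Z z = 1 ⊗ z.
Proof. by []. Qed.

Section Lift.
Variables (Z : lmodType B) (N : lmodType A) (h : {linear Z -> res_scalars f N}).

Lemma induced_lift : exists g : {linear induced f Z -> N},
  forall (a : A) z, g (a ⊗ z) = a *: (h z : N).
Proof.
pose b (a : right_regular_along f) z : N := (a : A) *: (h z : N).
have bDl (a a' : right_regular_along f) z : b (a + a') z = b a z + b a' z.
  by rewrite /b scalerDl.
have bDr (a : right_regular_along f) z z' : b a (z + z') = b a z + b a z'.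
  by rewrite /b linearD scalerDr.
have bM (a : right_regular_along f) (c : B) z : b ((c : B^c) *: a) z = b a (c *: z).
  by rewrite /b linearZ -scalerA.
have [g gE] : exists g : {additive induced f Z -> N}, forall (a : A) z, g (a ⊗ z) = b a z.
  exact: tensor_lift_exists bDl bDr bM.
have lg : linear g.
  by apply: induced_additive_linear => a c z; rewrite !gE /b scalerA.
by exists (lin_of lg).
Qed.

End Lift.

Variable F : frobenius f.
Local Notation p := (fr_proj F).
Local Notation r := (fr_basis F).

Lemma induced_proj_subproof Z : exists g : {linear res_scalars f (induced f Z) -> Z},
  forall (a : A) z, g (a ⊗ z) = p a *: z.
Proof.
pose b (a : right_regular_along f) z : Z := p a *: z.
have bDl (a a' : right_regular_along f) z : b (a + a') z = b a z + b a' z.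
  by rewrite /b raddfD scalerDl.
have bDr (a : right_regular_along f) z z' : b a (z + z') = b a z + b a z'.
  by rewrite /b scalerDr.
have bM (a : right_regular_along f) (c : B) z : b ((c : B^c) *: a) z = b a (c *: z).
  by rewrite /b scalerA -fr_projMr.
have [g gE] : exists g : {additive induced f Z -> Z}, forall (a : A) z, g (a ⊗ z) = b a z.
  exact: tensor_lift_exists bDl bDr bM.
have lg : linear (g : res_scalars f (induced f Z) -> Z).
  move=> a x y; rewrite raddfD; congr (_ + _); rewrite res_scalarsE.
  elim/induced_ind: x => [|c z|s t hs ht]; first by rewrite scaler0 raddf0 scaler0.
    by rewrite induced_scaleE !gE /b scalerA fr_projMl.
  by rewrite (scalerDr (f a) s t) !raddfD /= hs ht -scalerDr.
by exists (lin_of lg).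
Qed.

Definition induced_proj Z : {linear res_scalars f (induced f Z) -> Z} :=
  projT1 (cid (induced_proj_subproof Z)).

Lemma induced_projE Z (a : A) z : induced_proj Z (a ⊗ z) = p a *: z.
Proof. exact: (projT2 (cid (induced_proj_subproof Z))). Qed.

Lemma induced_unitK Z : cancel (induced_unit Z) (induced_proj Z).
Proof. by move=> z; rewrite [LHS]induced_projE fr_proj1 scale1r. Qed.

(** The dual bases give coordinates on the induced module: t is recovered from the elements
    [induced_proj Z (q.2 *: t)]. *)
Lemma induced_decomp Z (t : induced f Z) :
  t = \sum_(q <- r) q.1 ⊗ induced_proj Z (q.2 *: t).
Proof.
elim/induced_ind: t => [|a z|s t hs ht].
- by rewrite big1_seq // => q _; rewrite scaler0 raddf0 tens0r.
- under eq_bigr => q _ do rewrite induced_scaleE induced_projE tens_scale.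
  by rewrite -tens_suml fr_basisl.
- rewrite {1}hs {1}ht -big_split; apply: eq_bigr => q _.
  by rewrite (scalerDr q.2 s t) raddfD tensDr.
Qed.

Section Coinduce.
Variables (Z : lmodType B) (N : lmodType A) (h : {linear res_scalars f N -> Z}).

(* The map into the induced module adjoint to h, by the identification of the *)
(* induced with the coinduced module.                                         *)
Lemma coinduce_subproof : exists g : {linear N -> induced f Z},
  forall x, g x = \sum_(q <- r) q.1 ⊗ h (q.2 *: x).
Proof.
pose g x : induced f Z := \sum_(q <- r) q.1 ⊗ h (q.2 *: x).
have gD x y : g (x + y) = g x + g y.
  rewrite /g -big_split; apply: eq_bigr => q _.
  by rewrite scalerDr linearD tensDr.
have gZ a x : g (a *: x) = a *: g x.
  (* One dual basis identity expands q.2 a with coefficients in B, which move across the tensor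
     sign; the other then sums over q to a s.1. *)
  have hq q : q.1 ⊗ h (q.2 *: (a *: x)) =
      \sum_(s <- r) (q.1 * f (p (q.2 * (a * s.1)))) ⊗ h (s.2 *: x).
    rewrite scalerA -[q.2 * a](fr_basisr F) scaler_suml linear_sum tens_sumr.
    apply: eq_bigr => s _; rewrite -tens_scale -linearZ -mulrA.
    by rewrite -scalerA.
  rewrite /g (eq_bigr _ (fun q _ => hq q)) exchange_big /= scaler_sumr.
  by apply: eq_bigr => s _; rewrite -tens_suml fr_basisl induced_scaleE.
have lg : linear g by move=> a x y; rewrite gD gZ.
by exists (lin_of lg).
Qed.

Definition coinduce : {linear N -> induced f Z} := projT1 (cid coinduce_subproof).

Lemma coinduceE x : coinduce x = \sum_(q <- r) q.1 ⊗ h (q.2 *: x).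
Proof. exact: (projT2 (cid coinduce_subproof)). Qed.

Lemma coinduceK x : induced_proj Z (coinduce x) = h x.
Proof.
rewrite coinduceE [LHS]raddf_sum /=.
rewrite -[x in RHS]scale1r -(fr_basisr F 1) scaler_suml [RHS]linear_sum.
apply: eq_bigr => q _; rewrite induced_projE -linearZ mul1r -scalerA.
by [].
Qed.

End Coinduce.

End ScalarChange.

(** * Exactness, projectives, injectives and Ext under change of rings *)

Section Transfer.
Variables (A B : pzRingType) (f : {rmorphism B -> A}) (F : frobenius f).

Local Notation "a ⊗ z" := (tens (a : right_regular_along f) z) (at level 39).

Lemma induced_proj_map (Z Z' : lmodType B) (h : {linear Z -> Z'}) t :
  induced_proj F Z' (induced_map f h t) = h (induced_proj F Z t).
Proof.
elim/induced_ind: t => [|a z|s t hs ht]; first by rewrite !raddf0.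
  by rewrite induced_mapE !induced_projE linearZ.
by rewrite !raddfD /= hs ht.
Qed.

(** With naturality of [induced_proj], this lets exactness of induction be checked on coordinates,
    over B. *)
Lemma induced_ker (Z : lmodType B) (t : induced f Z) :
  (forall a, induced_proj F Z (a *: t) = 0) -> t = 0.
Proof.
move=> t0; rewrite [t](induced_decomp F) big1_seq // => q _.
by rewrite t0 tens0r.
Qed.

Lemma induced_map_inj (Z Z' : lmodType B) (h : {linear Z -> Z'}) :
  injective h -> injective (induced_map f h).
Proof.
move=> hinj s t st; apply/eqP; rewrite -subr_eq0; apply/eqP/induced_ker => a.
apply: hinj; rewrite -induced_proj_map linearZ linearB /= st subrr scaler0.
by rewrite !raddf0.
Qed.

Lemma induced_map_surj (Z Z' : lmodType B) (h : {linear Z -> Z'}) :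
  (forall y, exists x, h x = y) -> forall y, exists x, induced_map f h x = y.
Proof.
move=> hs; elim/induced_ind => [|a z|_ _ [s <-] [t <-]].
- by exists 0; rewrite raddf0.
- by have [x <-] := hs z; exists (a ⊗ x); rewrite induced_mapE.
- by exists (s + t); rewrite raddfD.
Qed.

Lemma induced_map_exact (U V W : lmodType B) (i : {linear U -> V}) (e : {linear V -> W}) :
  (forall x, e x = 0 -> exists y, i y = x) ->
  forall x, induced_map f e x = 0 -> exists y, induced_map f i y = x.
Proof.
move=> eker x x0.
have /boolp.choice[c cE] q : exists y, i y = induced_proj F V (q *: x).
  by apply: eker; rewrite -induced_proj_map linearZ /= x0 scaler0 raddf0.
exists (\sum_(q <- fr_basis F) q.1 ⊗ c q.2).
rewrite [LHS]linear_sum [RHS](induced_decomp F) /=; apply: eq_bigr => q _.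
by rewrite induced_mapE cE.
Qed.

(** Ind is left adjoint to Res, which preserves surjections. *)
Lemma induced_projective (P : lmodType B) :
  projective_module P -> projective_module (induced f P).
Proof.
move=> Pp U V e g es.
have [k kE] := Pp _ _ (res_map f e) (res_map f g \o induced_unit f P) es.
have [l lE] := induced_lift k; exists l => x.
elim/induced_ind: x => [|a z|s t hs ht]; first by rewrite !raddf0.
  rewrite lE linearZ [e (k z)]kE /= -linearZ /=; congr (g _).
  by rewrite [LHS]induced_scaleE mulr1.
by rewrite !raddfD /= hs ht.
Qed.

(** Res is left adjoint to Ind, which preserves surjections. *)
Lemma res_projective (P : lmodType A) :
  projective_module P -> projective_module (res_scalars f P).
Proof.
move=> Pp U V e g es.
have [k kE] := Pp _ _ _ (coinduce F g) (induced_map_surj es).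
exists (induced_proj F U \o res_map f k) => x.
by rewrite /= -induced_proj_map kE coinduceK.
Qed.

(** Ind is right adjoint to Res, which preserves injections. *)
Lemma induced_injective (E : lmodType B) :
  injective_module E -> injective_module (induced f E).
Proof.
move=> Ei X Y i g iinj.
have [k kE] := Ei _ _ (res_map f i) (induced_proj F E \o res_map f g) iinj.
exists (coinduce F k) => x; rewrite coinduceE [RHS](induced_decomp F).
apply: eq_bigr => q _; congr (_ ⊗ _).
by rewrite -linearZ [LHS]kE /= -linearZ.
Qed.

(** Res is right adjoint to Ind, which preserves injections. *)
Lemma res_injective (E : lmodType A) :
  injective_module E -> injective_module (res_scalars f E).
Proof.
move=> Ei X Y i g iinj; have [l lE] := induced_lift g.
have [k kE] := Ei _ _ (induced_map f i) l (induced_map_inj iinj).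
exists (res_map f k \o induced_unit f Y) => x.
by rewrite /= induced_unitE -induced_mapE [LHS]kE lE scale1r.
Qed.

Definition induced_resolution (C : proj_resolution B) : proj_resolution A.
Proof.
apply: (@ProjResolution A (fun n => induced f (om C n)) (fun n => induced f (pr C n))
  (fun n => induced_map f (inc C n)) (fun n => induced_map f (epi C n))) => n.
- by apply/induced_map_inj/inc_inj.
- by apply/induced_map_surj/epi_surj.
- elim/induced_ind => [|a z|s t hs ht]; first by rewrite !raddf0.
    by rewrite !induced_mapE epi_inc tens0r.
  by rewrite !raddfD /= hs ht addr0.
- by apply/induced_map_exact/epi_ker.
- by apply/induced_projective/pr_projective.
Defined.

Definition res_resolution (C : proj_resolution A) : proj_resolution B.
Proof.
apply: (@ProjResolution B (fun n => res_scalars f (om C n))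
  (fun n => res_scalars f (pr C n))
  (fun n => res_map f (inc C n)) (fun n => res_map f (epi C n))) => n.
- exact: inc_inj.
- exact: epi_surj.
- exact: epi_inc.
- exact: epi_ker.
- by apply/res_projective/pr_projective.
Defined.

Lemma ext_vanishes_res (C : proj_resolution B) n (N : lmodType A) :
  ext_vanishes (induced_resolution C) n N -> ext_vanishes C n (res_scalars f N).
Proof.
move=> CN g; have [l lE] := induced_lift g; have [k kE] := CN l.
exists (res_map f k \o induced_unit f (pr C n)) => x.
by rewrite /= induced_unitE -induced_mapE [LHS]kE lE scale1r.
Qed.

Lemma ext_vanishes_induced (C : proj_resolution A) n (M : lmodType B) :
  ext_vanishes (res_resolution C) n M -> ext_vanishes C n (induced f M).
Proof.
move=> CM g; have [k kE] := CM (induced_proj F M \o res_map f g).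
exists (coinduce F k) => x; rewrite coinduceE [RHS](induced_decomp F).
apply: eq_bigr => q _; congr (_ ⊗ _).
by rewrite -linearZ [LHS]kE /= -linearZ.
Qed.

End Transfer.

(** Serves to map out of iterated tensor products: the inner tensor is lifted first, and additivity
    in the last variable makes a second lift possible. *)
Lemma tensor_trilinear (S : pzRingType) (X : lmodType S^c) (Y : lmodType S)
    (V W : zmodType) (b : X -> Y -> V -> W) :
    (forall x x' y v, b (x + x') y v = b x y v + b x' y v) ->
    (forall x y y' v, b x (y + y') v = b x y v + b x y' v) ->
    (forall x (c : S) y v, b ((c : S^c) *: x) y v = b x (c *: y) v) ->
    (forall x y v v', b x y (v + v') = b x y v + b x y v') ->
  exists L : tensor X Y -> V -> W,
    [/\ forall v, L 0 v = 0, forall s t v, L (s + t) v = L s v + L t v,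
        forall t v v', L t (v + v') = L t v + L t v'
      & forall x y v, L (tens x y) v = b x y v].
Proof.
move=> bDl bDr bM bDv.
have /boolp.choice[L LE] v : exists g : {additive tensor X Y -> W},
    forall x y, g (tens x y) = b x y v.
  exact: tensor_lift_exists.
exists (fun t v => L v t); split=> [v|s t v|t v v'|x y v]; rewrite ?LE ?raddf0 ?raddfD //.
elim/tensor_ind: t => [|x y|s t hs ht]; first by rewrite !raddf0 addr0.
  by rewrite !LE bDv.
by rewrite !raddfD /= hs ht addrACA.
Qed.

(** * Right modules over the converse rings, and Tor under change of rings *)

Section Converse.
Variables (A B : pzRingType) (f : {rmorphism B -> A}).

Definition converse_map (g : B -> A) : B^c -> A^c := g.

Lemma converse_map_zmod : zmod_morphism (converse_map f).
Proof. by move=> x y; exact: (rmorphB f x y). Qed.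

Lemma converse_map_monoid : monoid_morphism (converse_map f).
Proof. by split=> [|x y]; [exact: (rmorph1 f) | exact: (rmorphM f y x)]. Qed.

HB.instance Definition _ := GRing.isZmodMorphism.Build B^c A^c (converse_map f)
  converse_map_zmod.
HB.instance Definition _ := GRing.isMonoidMorphism.Build B^c A^c (converse_map f)
  converse_map_monoid.

(** Left and right are exchanged, so the dual bases swap; the results on left modules then apply to
    the right-module argument of Tor. *)
Definition converse_frobenius (F : frobenius f) : frobenius (converse_map f).
Proof.
apply: (@Frobenius A^c B^c (converse_map f) (fr_proj F : {additive A^c -> B^c})
  [seq (q.2, q.1) | q <- fr_basis F]) => [b a|a b||a|a].
- exact: (fr_projMr F a b).
- exact: (fr_projMl F b a).
- exact: (fr_proj1 F).
- by rewrite big_map; exact: (fr_basisr F a).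
- by rewrite big_map; exact: (fr_basisl F a).
Defined.

Variable F : frobenius f.

(** [alpha] sends e ⊗ x to (1 ⊗ e) ⊗ x, from E ⊗_B Res N to Ind E ⊗_A N. Being natural along inc
    with left inverse [beta], it pulls injectivity back. *)
Lemma tor_vanishes_res (C : proj_resolution A) n (E : lmodType B^c) :
  tor_vanishes (induced (converse_map f) E) C n ->
  tor_vanishes E (res_resolution F C) n.
Proof.
pose I : lmodType A^c := induced (converse_map f) E.
have alpha (N : lmodType A) : exists g : {additive tensor E (res_scalars f N) -> tensor I N},
    forall e (x : N), g (tens e (x : res_scalars f N)) = tens (induced_unit _ E e : I) x.
  pose b e (x : res_scalars f N) : tensor I N := tens (induced_unit _ E e : I) (x : N).
  have bDl e1 e2 x : b (e1 + e2) x = b e1 x + b e2 x by rewrite /b linearD tensDl.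
  have bDr e x1 x2 : b e (x1 + x2) = b e x1 + b e x2 by exact: tensDr.
  have bM e (c : B) x : b ((c : B^c) *: e) x = b e (c *: x).
    by rewrite /b linearZ [LHS]tensM.
  exact: tensor_lift_exists bDl bDr bM.
have beta (N : lmodType A) : exists g : {additive tensor I N -> tensor E (res_scalars f N)},
    forall e x, g (tens (induced_unit _ E e : I) x) = tens e (x : res_scalars f N).
  pose b (a : right_regular_along (converse_map f)) e (x : N) : tensor E (res_scalars f N) :=
    tens e ((a : A) *: x : res_scalars f N).
  have [| | | |L [L0 LDl LDr LE]] := @tensor_trilinear _ _ _ _ _ b.
  - by move=> a a' e x; rewrite /b scalerDl [LHS]tensDr.
  - by move=> a e e' x; rewrite /b tensDl.
  - move=> a c e x; rewrite /b [RHS]tensM; congr tens.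
    by rewrite [RHS]scalerA.
  - by move=> a e x y; rewrite /b scalerDr [LHS]tensDr.
  have LM (t : I) (a : A) x : L ((a : A^c) *: t) x = L t (a *: x).
    elim/induced_ind: t => [|c e|s t hs ht].
    - by rewrite scaler0 [LHS]L0 [RHS]L0.
    - by rewrite induced_scaleE !LE /b scalerA.
    - by rewrite (scalerDr (a : A^c) s t) !LDl hs ht.
  have [g gE] := @tensor_lift_exists A I N _ L LDl LDr (fun t a => LM t a).
  by exists g => e x; rewrite gE [LHS]LE /b scale1r.
move=> IC t t0; have [g gE] := alpha (om C n.+1); have [g' g'E] := alpha (pr C n).
have [k kE] := beta (om C n.+1).
have gK : k (g t) = t.
  elim/tensor_ind: t {t0} => [|e x|t1 t2 h1 h2]; first by rewrite !raddf0.
    by rewrite gE kE.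
  by rewrite !raddfD /= h1 h2.
suff /(IC (g t)) gt0 : tensor_map idfun (inc _ n) (g t) = 0 by rewrite -gK gt0 raddf0.
transitivity (g' (tensor_map idfun (inc (res_resolution F C) n) t)); last first.
  by rewrite t0 raddf0.
elim/tensor_ind: t {t0 gK} => [|e x|t1 t2 h1 h2]; first by rewrite !raddf0.
  by rewrite gE !tensor_map_tens g'E.
by rewrite !raddfD /= h1 h2.
Qed.

(** Here [alpha] sends e ⊗ (a ⊗ z) to ea ⊗ z, from E ⊗_A Ind Z to Res E ⊗_B Z. *)
Lemma tor_vanishes_induced (C : proj_resolution B) n (E : lmodType A^c) :
  tor_vanishes (res_scalars (converse_map f) E) C n ->
  tor_vanishes E (induced_resolution F C) n.
Proof.
pose E' : lmodType B^c := res_scalars (converse_map f) E.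
have alpha (Z : lmodType B) : exists g : {additive tensor E (induced f Z) -> tensor E' Z},
    forall e (a : A) z, g (tens e (tens (a : right_regular_along f) z : induced f Z)) =
      tens ((a : A^c) *: e : E') z.
  pose b (a : right_regular_along f) z (e : E) : tensor E' Z := tens ((a : A^c) *: e : E') z.
  have [| | | |L [L0 LDl LDr LE]] := @tensor_trilinear _ _ _ _ _ b.
  - by move=> a a' z e; rewrite /b scalerDl [LHS]tensDl.
  - by move=> a z z' e; rewrite /b tensDr.
  - move=> a c z e; rewrite /b -[RHS]tensM; congr tens.
    by rewrite [RHS]scalerA.
  - by move=> a z e e'; rewrite /b scalerDr [LHS]tensDl.
  have LM (e : E) (a : A) (t : induced f Z) : L t ((a : A^c) *: e) = L (a *: t) e.
    elim/induced_ind: t => [|c z|s t hs ht].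
    - by rewrite scaler0 [LHS]L0 [RHS]L0.
    - by rewrite induced_scaleE !LE /b scalerA.
    - by rewrite (scalerDr a s t) !LDl hs ht.
  have [g gE] := @tensor_lift_exists A E (induced f Z) _ (fun e t => L t e)
    (fun e e' t => LDr t e e') (fun e s t => LDl s t e) LM.
  by exists g => e a z; rewrite gE [LHS]LE.
have beta (Z : lmodType B) : exists g : {additive tensor E' Z -> tensor E (induced f Z)},
    forall e z, g (tens e z) = tens (e : E) (induced_unit f Z z : induced f Z).
  pose b (e : E') z : tensor E (induced f Z) := tens (e : E) (induced_unit f Z z : induced f Z).
  have bDl e1 e2 x : b (e1 + e2) x = b e1 x + b e2 x by exact: tensDl.
  have bDr e x1 x2 : b e (x1 + x2) = b e x1 + b e x2.
    by rewrite /b linearD [LHS]tensDr.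
  have bM e (c : B) x : b ((c : B^c) *: e) x = b e (c *: x).
    by rewrite /b linearZ -[RHS]tensM.
  exact: tensor_lift_exists bDl bDr bM.
move=> IC t t0; have [g gE] := alpha (om C n.+1); have [g' g'E] := alpha (pr C n).
have [k kE] := beta (om C n.+1).
have gK : k (g t) = t.
  elim/tensor_ind: t {t0} => [|e|t1 t2 h1 h2]; first by rewrite !raddf0.
    elim/induced_ind => [|a z|t1 t2 h1 h2]; first by rewrite tens0r !raddf0.
      rewrite gE kE [LHS]tensM; congr tens.
      by rewrite [LHS]induced_scaleE mulr1.
    by rewrite tensDr !raddfD /= h1 h2.
  by rewrite !raddfD /= h1 h2.
suff /(IC (g t)) gt0 : tensor_map idfun (inc _ n) (g t) = 0 by rewrite -gK gt0 raddf0.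
transitivity (g' (tensor_map idfun (inc (induced_resolution F C) n) t)); last first.
  by rewrite t0 raddf0.
elim/tensor_ind: t {t0 gK} => [|e|t1 t2 h1 h2]; first by rewrite !raddf0.
  elim/induced_ind => [|a z|t1 t2 h1 h2]; first by rewrite tens0r !raddf0.
    by rewrite gE !tensor_map_tens [induced_map _ _ _]induced_mapE g'E.
  by rewrite tensDr !raddfD /= h1 h2.
by rewrite !raddfD /= h1 h2.
Qed.

End Converse.

Lemma least_or_oo_le (P Q : nat -> Prop) :
  (forall n, Q n -> P n) -> (least_or_oo P <= least_or_oo Q)%E.
Proof.
move=> QP; rewrite /least_or_oo; case: (pselect (exists n, `[< Q n >])) => [exQ|_]; last exact: leey.
case: pselect => [exP|[]]; last first.
  by have [n /asboolP Qn] := exQ; exists n; apply/asboolP/QP.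
rewrite lee_fin lez_nat; case: ex_minnP => m _ minm; apply: minm.
by case: ex_minnP => k /asboolP Qk _; apply/asboolP/QP.
Qed.

(** * Copure dimensions and retracts *)

Section CopureDimension.
Variable A : pzRingType.

(** Since [ext_vanishes] at m concerns degree m + 1, the range i >= 1 becomes i >= 0. *)
Lemma copure_inj_dimE (M : lmodType A) : copure_inj_dim M =
  least_or_oo (fun n => forall E : lmodType A, injective_module E ->
    forall i, ext_vanishes (free_resolution E) (n + i) M).
Proof.
congr least_or_oo; apply/funext => n; apply/propext; split=> h E Ei i.
  by apply/Ext_eq0P; have := h E Ei i.+1 isT; rewrite addnS.
by case: i => // i _; rewrite addnS; apply/Ext_eq0P/h.
Qed.

Lemma copure_flat_dimE (M : lmodType A) : copure_flat_dim M =
  least_or_oo (fun n => forall E : lmodType A^c, injective_module E ->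
    forall i, tor_vanishes E (free_resolution M) (n + i)).
Proof.
congr least_or_oo; apply/funext => n; apply/propext; split=> h E Ei i.
  by apply/Tor_eq0P; have := h E Ei i.+1 isT; rewrite addnS.
by case: i => // i _; rewrite addnS; apply/Tor_eq0P/h.
Qed.

Lemma copure_inj_dim_retract (M M' : lmodType A) (u : {linear M -> M'})
    (w : {linear M' -> M}) : cancel u w -> (copure_inj_dim M <= copure_inj_dim M')%E.
Proof.
move=> uK; rewrite !copure_inj_dimE; apply: least_or_oo_le => n h E Ei i g.
have [k kE] := h E Ei i (u \o g).
by exists (w \o k) => x; rewrite /= kE /= uK.
Qed.

Lemma copure_flat_dim_retract (M M' : lmodType A) (u : {linear M -> M'})
    (w : {linear M' -> M}) : cancel u w -> (copure_flat_dim M <= copure_flat_dim M')%E.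
Proof.
move=> uK; rewrite !copure_flat_dimE; apply: least_or_oo_le => n h E Ei i.
exact: (@tor_vanishes_retract _ (free_resolution M) (free_resolution M') u w uK _ _ (h E Ei i)).
Qed.

End CopureDimension.

(** * Copure dimensions along a Frobenius extension *)

Section CopureTransfer.
Variables (A B : pzRingType) (f : {rmorphism B -> A}) (F : frobenius f).

Lemma copure_inj_dim_res (N : lmodType A) :
  (copure_inj_dim (res_scalars f N) <= copure_inj_dim N)%E.
Proof.
rewrite !copure_inj_dimE; apply: least_or_oo_le => n h E Ei i.
apply: (@ext_vanishes_res _ _ f F).
exact: (@ext_vanishes_retract _ (induced_resolution F (free_resolution E))
  (free_resolution (induced f E)) idfun idfun (fun _ => erefl) _ _
  (h _ (induced_injective F Ei) i)).
Qed.

Lemma copure_inj_dim_induced_le (M : lmodType B) :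
  (copure_inj_dim (induced f M) <= copure_inj_dim M)%E.
Proof.
rewrite !copure_inj_dimE; apply: least_or_oo_le => n h E Ei i.
apply: (@ext_vanishes_induced _ _ f F).
exact: (@ext_vanishes_retract _ (res_resolution F (free_resolution E))
  (free_resolution (res_scalars f E)) idfun idfun (fun _ => erefl) _ _
  (h _ (res_injective F Ei) i)).
Qed.

Lemma copure_inj_dim_induced (M : lmodType B) :
  copure_inj_dim (induced f M) = copure_inj_dim M.
Proof.
apply/eqP; rewrite eq_le copure_inj_dim_induced_le /=.
exact: le_trans (copure_inj_dim_retract (@induced_unitK _ _ f F M)) (copure_inj_dim_res _).
Qed.

Lemma copure_flat_dim_res (N : lmodType A) :
  (copure_flat_dim (res_scalars f N) <= copure_flat_dim N)%E.
Proof.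
rewrite !copure_flat_dimE; apply: least_or_oo_le => n h E Ei i.
apply: (@tor_vanishes_retract _ (free_resolution (res_scalars f N))
  (res_resolution F (free_resolution N)) idfun idfun (fun _ => erefl)).
exact/tor_vanishes_res/h/induced_injective/Ei/converse_frobenius.
Qed.

Lemma copure_flat_dim_induced_le (M : lmodType B) :
  (copure_flat_dim (induced f M) <= copure_flat_dim M)%E.
Proof.
rewrite !copure_flat_dimE; apply: least_or_oo_le => n h E Ei i.
apply: (@tor_vanishes_retract _ (free_resolution (induced f M))
  (induced_resolution F (free_resolution M)) idfun idfun (fun _ => erefl)).
exact/tor_vanishes_induced/h/res_injective/Ei/converse_frobenius.
Qed.

Lemma copure_flat_dim_induced (M : lmodType B) :
  copure_flat_dim (induced f M) = copure_flat_dim M.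
Proof.
apply/eqP; rewrite eq_le copure_flat_dim_induced_le /=.
exact: le_trans (copure_flat_dim_retract (@induced_unitK _ _ f F M)) (copure_flat_dim_res _).
Qed.

Lemma separable_retract (N : lmodType A) : separable_extension f ->
  exists (u : {linear N -> induced f (res_scalars f N)})
    (w : {linear induced f (res_scalars f N) -> N}), cancel u w.
Proof.
move=> /separable_extensionP[r [rC r1]].
have [w wE] := @induced_lift _ _ f (res_scalars f N) N idfun.
pose u (x : N) : induced f (res_scalars f N) :=
  \sum_(q <- r) tens (q.1 : right_regular_along f) (q.2 *: x : res_scalars f N).
have uD x y : u (x + y) = u x + u y.
  by rewrite /u -big_split; apply: eq_bigr => q _; rewrite scalerDr [LHS]tensDr.
have uZ a x : u (a *: x) = a *: u x.
  (* Pushing the centrality identity [rC] forward along c |-> c x yields u (a x) = a u (x). *)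
  pose m (c : res_scalars f A^o) : res_scalars f N := (c : A) *: x.
  have lm : linear m.
    by move=> b c d; rewrite /m scalerDl; congr (_ + _); rewrite -[RHS]/(f b *: ((c : A) *: x)) scalerA.
  have := congr1 (tensor_map (idfun : {linear right_regular_along f -> _}) (lin_of lm)) (rC a).
  rewrite !raddf_sum /= => e; apply: etrans (etrans e _).
    by apply: eq_bigr => q _; rewrite tensor_map_tens scalerA.
  by apply: eq_bigr => q _; rewrite tensor_map_tens induced_scaleE.
have lu : linear u by move=> a x y; rewrite uD uZ.
exists (lin_of lu), w => x; rewrite [LHS]raddf_sum /=.
under eq_bigr => q _ do rewrite wE scalerA.
by rewrite -scaler_suml r1 scale1r.
Qed.

Lemma copure_inj_dim_separable (N : lmodType A) : separable_extension f ->
  copure_inj_dim (res_scalars f N) = copure_inj_dim N.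
Proof.
move=> /(separable_retract N)[u [w uK]]; apply/eqP; rewrite eq_le copure_inj_dim_res /=.
by rewrite -(copure_inj_dim_induced (res_scalars f N)) (copure_inj_dim_retract uK).
Qed.

Lemma copure_flat_dim_separable (N : lmodType A) : separable_extension f ->
  copure_flat_dim (res_scalars f N) = copure_flat_dim N.
Proof.
move=> /(separable_retract N)[u [w uK]]; apply/eqP; rewrite eq_le copure_flat_dim_res /=.
by rewrite -(copure_flat_dim_induced (res_scalars f N)) (copure_flat_dim_retract uK).
Qed.

End CopureTransfer.

(** * The skew group ring as a Frobenius extension of that of a subgroup *)

Section SkewFrobenius.
Variables (G : finGroupType) (R : pzRingType) (act : ring_action G R).
Variable H : {group G}.
Implicit Types (a : skew_ring act) (b : skew_ring (sub_action act H)).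

Local Notation iota := (skew_incl (act := act) (H := H)).

Definition skew_res a : skew_ring (sub_action act H) := [ffun h => a (sgval h)].

Lemma skew_res_zmod : zmod_morphism skew_res.
Proof. by move=> a c; apply/ffunP => h; rewrite !ffunE. Qed.

HB.instance Definition _ := GRing.isZmodMorphism.Build _ _ skew_res skew_res_zmod.

Lemma skew_incl_res a g : iota (skew_res a) g = if g \in H then a g else 0.
Proof. by rewrite ffunE; case: ifP => // gH; rewrite ffunE subgK. Qed.

Lemma skew_mono1l g a k : (skew_mono act 1 g * a) k = act g (a (g^-1 * k)%g).
Proof.
rewrite ffunE (bigD1 g) //= big1 => [|h hg]; first by rewrite ffunE eqxx mul1r addr0.
by rewrite ffunE (negbTE hg) mul0r.
Qed.

Lemma skew_mono1r g a k : (a * skew_mono act 1 g) k = a (k * g^-1)%g.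
Proof.
rewrite ffunE (bigD1 (k * g^-1)%g) //= big1 => [|h hg].
  by rewrite ffunE invMg invgK mulgKV eqxx rmorph1 mulr1 addr0.
rewrite ffunE; case: eqP => [hk|_]; last by rewrite rmorph0 mulr0.
by rewrite -hk invMg invgK mulKVg eqxx in hg.
Qed.

Lemma skew_resMl b a : skew_res (iota b * a) = b * skew_res a.
Proof.
apply/ffunP => k; rewrite !ffunE (bigID (mem H)) /= [X in _ + X]big1 ?addr0 => [|g gH].
  rewrite (reindex_onto sgval (subg H)) /= => [|g gH]; last exact: subgK.
  apply: eq_big => [h|h _]; first by rewrite subgP sgvalK eqxx.
  by rewrite !ffunE subgP sgvalK.
by rewrite ffunE (negbTE gH) mul0r.
Qed.

Lemma skew_resMr a b : skew_res (a * iota b) = skew_res a * b.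
Proof.
apply/ffunP => k; rewrite !ffunE (bigID (mem H)) /= [X in _ + X]big1 ?addr0 => [|g gH].
  rewrite (reindex_onto sgval (subg H)) /= => [|g gH]; last exact: subgK.
  apply: eq_big => [h|h _]; first by rewrite subgP sgvalK eqxx.
  rewrite !ffunE groupM ?groupV ?subgP //; congr (_ * act _ (b _)).
  by apply: subg_inj; rewrite /= subgK ?groupM ?groupV ?subgP.
by rewrite ffunE groupMr ?subgP // groupV (negbTE gH) rmorph0 mulr0.
Qed.

Lemma skew_res1 : skew_res 1 = 1.
Proof. by apply/ffunP => h; rewrite !ffunE -(inj_eq (@subg_inj _ H)). Qed.

(** Only the coset C = kH contributes, since (repr C)^-1 k lies in H exactly when k lies in C. *)
Lemma sum_lcosets_repr (v : R) (k : G) :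
  \sum_(C in lcosets H [set: G]) (if ((repr C)^-1 * k)%g \in H then v else 0) = v.
Proof.
have kH : (k *: H)%g \in lcosets H [set: G] by apply/lcosetsP; exists k; rewrite ?inE.
have kC C : C \in lcosets H [set: G] -> (((repr C)^-1 * k)%g \in H) = (C == (k *: H)%g).
  case/lcosetsP => g _ ->; rewrite -mem_lcoset.
  have -> : (repr (g *: H) *: H = g *: H)%g by apply/lcoset_eqP/(mem_repr g)/lcoset_refl.
  by apply/idP/eqP => [/lcoset_eqP|->]; rewrite ?lcoset_refl.
rewrite (bigD1 (k *: H)%g) //= kC // eqxx big1 ?addr0 // => C /andP[CH Ck].
by rewrite kC // (negbTE Ck).
Qed.

Definition skew_basis : seq (skew_ring act * skew_ring act) :=
  [seq (skew_mono act 1 (repr C), skew_mono act 1 (repr C)^-1%g)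
  | C <- enum (lcosets H [set: G])].

Definition skew_frobenius : frobenius iota.
Proof.
apply: (@Frobenius _ _ iota skew_res skew_basis skew_resMl skew_resMr skew_res1) => a.
  (* For a representative g, the term g p(g^-1 a) has at k the coefficient g(g^-1(a k)) = a k if
     g^-1 k is in H, and 0 otherwise. *)
  rewrite big_map big_enum; apply/ffunP => k; rewrite -[RHS](sum_lcosets_repr _ k).
  rewrite sum_ffunE; apply: eq_bigr => C _.
  rewrite skew_mono1l skew_incl_res; case: ifP => _; last exact: rmorph0.
  by rewrite skew_mono1l invgK mulKVg -ring_actM mulgV ring_act1.
(* The term p(a g) g^-1 has coefficient a k at k if kg is in H, that is g^-1 k^-1 is in H: inversion
   lets the left coset representatives serve on this side too. *)
rewrite big_map big_enum; apply/ffunP => k; rewrite -[RHS](sum_lcosets_repr _ k^-1%g).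
rewrite sum_ffunE; apply: eq_bigr => C _.
rewrite skew_mono1r skew_incl_res invgK -groupV invMg.
by case: ifP => // _; rewrite skew_mono1r mulgK.
Defined.

End SkewFrobenius.

Theorem proposition7p1 (R : pzRingType) (G : finGroupType)
    (act : ring_action G R) (H : {group G})
    (M : lmodType (skew_ring (sub_action act H))) (N : lmodType (skew_ring act)) :
  let iota : {rmorphism skew_ring (sub_action act H) -> skew_ring act} :=
    skew_incl (act := act) (H := H) in
  [/\ (copure_inj_dim (res_scalars iota N) <= copure_inj_dim N)%E /\
        (separable_extension iota -> copure_inj_dim (res_scalars iota N) = copure_inj_dim N),
      copure_inj_dim (induced iota M) = copure_inj_dim M,
      copure_flat_dim (induced iota M) = copure_flat_dim M
    & (copure_flat_dim (res_scalars iota N) <= copure_flat_dim N)%E /\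
        (separable_extension iota -> copure_flat_dim (res_scalars iota N) = copure_flat_dim N)].
Proof.
move=> iota; have F : frobenius iota := skew_frobenius act H.
split; last split; first split.
- exact: copure_inj_dim_res F N.
- exact: copure_inj_dim_separable F N.
- exact: copure_inj_dim_induced F M.
- exact: copure_flat_dim_induced F M.
- exact: copure_flat_dim_res F N.
- exact: copure_flat_dim_separable F N.
Qed.
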